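(* Fix a dilation constant $\lambda\in\mathbb{R}$ and consider the $G$-invariant Laplacian soliton ODE system with dilation constant $\lambda$ (for $G=\mathrm{Sp}(2)$ or $G=\mathrm{SU}(3)$). The space of solutions to this ODE system that exist on $I\times P$ for some interval $I\subset\mathbb{R}$ has, up to translation in $t$, (i) dimension $2$ for $G=\mathrm{Sp}(2)$ and $P=\mathbb{CP}^3$; (ii) dimension $4$ for $G=\mathrm{SU}(3)$ and $P=\mathrm{SU}(3)/T^2$.
   Context: A Laplacian soliton on a 7-manifold is a triple $(\varphi,X,\lambda)$ with $\varphi$ a $G_2$-structure (positive 3-form), $X$ a vector field, $\lambda\in\mathbb{R}$, such that $d\varphi=0$ and $\Delta_\varphi\varphi=\lambda\varphi+\mathcal{L}_X\varphi$ ($\Delta_\varphi$ the Hodge Laplacian of the metric induced by $\varphi$). The $\mathrm{SU}(3)$-invariant soliton ODE system with dilation constant $\lambda$: unknowns are functions $f_1,f_2,f_3:I\to(0,\infty)$ and $u:I\to\mathbb{R}$ on an interval $I$, satisfying $2(f_1f_2f_3)'=f_1^2+f_2^2+f_3^2$, $\;(\tau_i-uf_i^2)'=\lambda f_i^2$ for $i=1,2,3$, and $\tau_1+\tau_2+\tau_3=u(f_1^2+f_2^2+f_3^2)+2\lambda f_1f_2f_3$, where $\tau_i:=(f_i^2)'+\frac{f_i^2}{f_1f_2f_3}\bigl(2f_i^2-(f_1^2+f_2^2+f_3^2)\bigr)$. A solution corresponds to an $\mathrm{SU}(3)$-invariant Laplacian soliton on $I\times \mathrm{SU}(3)/T^2$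 ($T^2$ the maximal torus) with $X=u\,\partial_t$ and metric $dt^2+\sum f_i^2g_i$, with $g_1,g_2,g_3$ the invariant bilinear forms on the three irreducible summands of the isotropy representation. The $\mathrm{Sp}(2)$-invariant soliton ODE system with dilation constant $\lambda$ (on $I\times\mathbb{CP}^3$, $\mathbb{CP}^3=\mathrm{Sp}(2)/(\mathrm{Sp}(1)\times \mathrm{U}(1))$) is the $\mathrm{SU}(3)$-invariant soliton ODE system with $f_2=f_3$ (hence $\tau_2=\tau_3$), in the unknowns $(f_1,f_2,u)$. Explicitly, the unknowns are functions $f_1,f_2:I\to(0,\infty)$ and $u:I\to\mathbb{R}$ satisfying $2(f_1f_2^2)'=f_1^2+2f_2^2$, $\;(\tau_1-uf_1^2)'=\lambda f_1^2$, $\;(\tau_2-uf_2^2)'=\lambda f_2^2$, and $\tau_1+2\tau_2=u(f_1^2+2f_2^2)+2\lambda f_1f_2^2$, where $\tau_1:=(f_1^2)'-2f_1+\frac{f_1^3}{f_2^2}$ and $\tau_2:=(f_2^2)'-f_1$. Meaning of dimension: ''dimension $n$ up to translation in $t$'' means that the germs at a given $t_0$ of solutions form, via the values at $t_0$ of $(f,\tau)$, a smooth $(n+1)$-dimensional manifold, one dimension of which is accounted for by translating solutions in $t$. *)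

(* Defs.v *)
From HB Require Import structures.
From mathcomp Require Import all_boot all_order all_algebra.
From mathcomp Require Import all_classical all_reals all_analysis.
Set Implicit Arguments.
Unset Strict Implicit.
Unset Printing Implicit Defensive.
Import Order.TTheory GRing.Theory Num.Theory numFieldNormedType.Exports.
Local Open Scope classical_set_scope.
Local Open Scope ring_scope.

Section Smoothness.
Context {R : realType}.

(* C^k scalar functions on U; meant for open U only. *)
Fixpoint Ck_on (N k : nat) (U : set 'rV[R]_N) (f : 'rV[R]_N -> R) : Prop :=
  match k with
  | 0%N => forall x, U x -> {for x, continuous f}
  | k'.+1 => (forall x, U x -> differentiable f x) /\
      forall i : 'I_N, Ck_on k' U (fun x => 'D_(delta_mx 0 i) f x)
  end.

Definition smooth_on (N P : nat) (U : set 'rV[R]_N)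
    (F : 'rV[R]_N -> 'rV[R]_P) : Prop :=
  forall (k : nat) (j : 'I_P), Ck_on k U (fun x => F x 0 j).

(* Embedded submanifolds, through slice charts: near each of its points, M is
   straightened by a diffeomorphism Phi : U -> V, with inverse Psi, onto the
   zero set of the last N - d coordinates. *)
Definition smooth_submanifold (N d : nat) (M : set 'rV[R]_N) : Prop :=
  (d <= N)%N /\
  forall p, M p ->
  exists (U V : set 'rV[R]_N) (Phi Psi : 'rV[R]_N -> 'rV[R]_N),
    [/\ [/\ open U, U p & open V],
        smooth_on U Phi /\ smooth_on V Psi,
        forall x, U x -> V (Phi x) /\ Psi (Phi x) = x,
        forall y, V y -> U (Psi y) /\ Phi (Psi y) = y &
        forall x, U x ->
          (M x <-> forall i : 'I_N, (d <= i)%N -> Phi x 0 i = 0)].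

End Smoothness.

Section DimensionUpToTranslation.
Context {R : realType} {T : Type} {N : nat}.

(* [sol I X]: X is a solution on the open interval I (its values off I are
   irrelevant). [value X t]: the vector by which the germ of X at t is
   recorded. *)
Variables (sol : set R -> (R -> T) -> Prop) (value : (R -> T) -> R -> 'rV[R]_N).

Definition translate (s : R) (X : R -> T) : R -> T := fun t => X (t + s).

Definition germ_values (t0 : R) : set 'rV[R]_N :=
  [set p | exists I X, [/\ sol I X, I t0 & value X t0 = p]].

Definition dimension_up_to_translation (n : nat) : Prop :=
  forall t0 : R,
  [/\ (* germs at t0 correspond bijectively to points of germ_values t0 *)
      forall I J X Y, sol I X -> I t0 -> sol J Y -> J t0 ->
        (value X t0 = value Y t0 <-> \forall t \near t0, X t = Y t),
      (* nonemptiness is needed since the empty set is a manifold of every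
         dimension *)
      germ_values t0 !=set0,
      smooth_submanifold n.+1 (germ_values t0) &
      (* translating solutions in t is the local flow of a smooth nowhere
         vanishing vector field on germ_values t0, so that the translation
         orbits are 1-dimensional and account for one dimension *)
      exists (W : set 'rV[R]_N) (v : 'rV[R]_N -> 'rV[R]_N),
        [/\ open W, germ_values t0 `<=` W, smooth_on W v,
            (forall p, germ_values t0 p -> v p != 0) &
            forall I X s, sol I X -> I (t0 + s) ->
              sol [set t | I (t + s)] (translate s X) /\
              is_derive s (1 : R) (fun r => value (translate r X) t0)
                (v (value (translate s X) t0))]].

End DimensionUpToTranslation.

Section SolitonSystems.
Context {R : realType}.

(* In both systems the unknown X t is ((f_i(t))_i, u(t)). Germs only involve
   interior points, so the intervals are taken open. No regularity is assumed
   beyond what is needed for the equations to make sense; the equations then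
   force f and u to be smooth. *)

Section SU3.
Variable X : R -> 'rV[R]_3 * R.

Definition SU3_f (i : 'I_3) (t : R) : R := (X t).1 0 i.
Definition SU3_u (t : R) : R := (X t).2.
Definition SU3_prod (t : R) : R := \prod_(i < 3) SU3_f i t.
Definition SU3_sumsq (t : R) : R := \sum_(i < 3) SU3_f i t ^+ 2.

Definition SU3_tau (i : 'I_3) (t : R) : R :=
  derive1 (fun s => SU3_f i s ^+ 2) t
  + SU3_f i t ^+ 2 / SU3_prod t * (2 * SU3_f i t ^+ 2 - SU3_sumsq t).

Definition SU3_value (t : R) : 'rV[R]_(3 + 3) :=
  row_mx (\row_i SU3_f i t) (\row_i SU3_tau i t).
End SU3.

Definition SU3_soliton (lambda : R) (I : set R) (X : R -> 'rV[R]_3 * R)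
    : Prop :=
  [/\ open I, is_interval I &
  forall t, I t ->
  [/\ forall i, 0 < SU3_f X i t /\ derivable (SU3_f X i) t 1,
      2 * derive1 (SU3_prod X) t = SU3_sumsq X t,
      forall i, is_derive t (1 : R)
        (fun s => SU3_tau X i s - SU3_u X s * SU3_f X i s ^+ 2)
        (lambda * SU3_f X i t ^+ 2) &
      \sum_(i < 3) SU3_tau X i t
        = SU3_u X t * SU3_sumsq X t + 2 * lambda * SU3_prod X t]].

Section Sp2.
Variable X : R -> 'rV[R]_2 * R.

Definition Sp2_f1 (t : R) : R := (X t).1 0 0.
Definition Sp2_f2 (t : R) : R := (X t).1 0 1.
Definition Sp2_u (t : R) : R := (X t).2.

Definition Sp2_tau1 (t : R) : R :=
  derive1 (fun s => Sp2_f1 s ^+ 2) t - 2 * Sp2_f1 t + Sp2_f1 t ^+ 3 / Sp2_f2 t ^+ 2.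
Definition Sp2_tau2 (t : R) : R :=
  derive1 (fun s => Sp2_f2 s ^+ 2) t - Sp2_f1 t.

Definition Sp2_value (t : R) : 'rV[R]_4 :=
  \row_(i < 4) [:: Sp2_f1 t; Sp2_f2 t; Sp2_tau1 t; Sp2_tau2 t]`_i.
End Sp2.

Definition Sp2_soliton (lambda : R) (I : set R) (X : R -> 'rV[R]_2 * R)
    : Prop :=
  [/\ open I, is_interval I &
  forall t, I t ->
  [/\ [/\ 0 < Sp2_f1 X t, derivable (Sp2_f1 X) t 1,
          0 < Sp2_f2 X t & derivable (Sp2_f2 X) t 1],
      2 * derive1 (fun s => Sp2_f1 X s * Sp2_f2 X s ^+ 2) t
        = Sp2_f1 X t ^+ 2 + 2 * Sp2_f2 X t ^+ 2,
      is_derive t (1 : R)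
        (fun s => Sp2_tau1 X s - Sp2_u X s * Sp2_f1 X s ^+ 2)
        (lambda * Sp2_f1 X t ^+ 2),
      is_derive t (1 : R)
        (fun s => Sp2_tau2 X s - Sp2_u X s * Sp2_f2 X s ^+ 2)
        (lambda * Sp2_f2 X t ^+ 2) &
      Sp2_tau1 X t + 2 * Sp2_tau2 X t
        = Sp2_u X t * (Sp2_f1 X t ^+ 2 + 2 * Sp2_f2 X t ^+ 2)
          + 2 * lambda * (Sp2_f1 X t * Sp2_f2 X t ^+ 2)]].

End SolitonSystems.

(* Main.v *)
Require Import Defs.
From HB Require Import structures.
From mathcomp Require Import all_boot all_order all_algebra.
From mathcomp Require Import all_classical all_reals all_analysis.
From mathcomp Require Import ring lra.
Import Order.TTheory GRing.Theory Num.Theory numFieldNormedType.Exports.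
Local Open Scope classical_set_scope.
Local Open Scope ring_scope.
Set Implicit Arguments.
Unset Strict Implicit.
Unset Printing Implicit Defensive.

(* The two systems are the cases of multiplicities (1, 1, 1) and (1, 2) of one
   system: in both, sum_i m_i = 3. Put F_i = f_i^2, P = prod_i f_i^(m_i) and
   S = sum_i m_i F_i. By definition of tau, F_i' = tau_i - (F_i / P)(2 F_i - S),
   whence 2 P' = g P + S with g = sum_i m_i tau_i / F_i; so the first equation
   says g = 0, and the last one gives u in terms of (f, tau). On g = 0 we have
   u = - 1/3 sum_i m_i w_i / F_i with w_i = tau_i - u F_i, and w_i' = lambda F_i
   then determines u', hence tau_i'. The solitons thus are the integral curves
   of a smooth vector field in (f, tau)-space lying on {g = 0}, and g is a first
   integral of that field. As g is affine in tau, {g = 0} is a hypersurface,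
   and Picard-Lindelof puts exactly one germ of a solution through each of its
   points. The field does not vanish there, since 2 P' = S > 0. *)

(** * Ordinary differential equations *)

Lemma le_coord_mx_norm (R : realType) m n (A : 'M[R]_(m, n)) i j :
  `|A i j| <= `|A|.
Proof.
by rewrite [leRHS]/Num.Def.normr/= mx_normrE; exact: (le_bigmax _ _ (i, j)).
Qed.

(** The hypothesis [0 <= c] covers matrices without entries, whose norm is 0. *)
Lemma mx_norm_le (R : realType) m n (A : 'M[R]_(m, n)) c : 0 <= c ->
  (forall i j, `|A i j| <= c) -> `|A| <= c.
Proof.
move=> c0 Ac; rewrite [leLHS]/Num.Def.normr/= mx_normrE.
by apply: bigmax_le => // -[i j] _; exact: Ac.
Qed.

Lemma is_derive_rowP (R : realType) (V : normedModType R) N (x : V -> 'rV[R]_N)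
    (t v : V) (dx : 'rV[R]_N) :
  is_derive t v x dx <-> forall i, is_derive t v (fun s => x s 0 i) (dx 0 i).
Proof.
split=> [[dvx <-] i|H].
  rewrite derive_mx// mxE; apply: DeriveDef => //.
  by have /derivable_mxP := dvx; exact.
have dvx : derivable x t v.
  by apply/derivable_mxP => i j; rewrite ord1; have [] := H j.
apply: DeriveDef => //; rewrite derive_mx//; apply/rowP => i; rewrite mxE.
by have [] := H i.
Qed.

Lemma norm_derive_le (R : realType) (I : set R) (f df : R -> R) C :
  is_interval I -> (forall t, I t -> is_derive t 1 f (df t)) ->
  (forall t, I t -> `|df t| <= C) ->
  forall s t, I s -> I t -> `|f t - f s| <= C * `|t - s|.
Proof.
move=> itvI f' dfC.
suff lt_case s t : I s -> I t -> s < t -> `|f t - f s| <= C * `|t - s|.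
  move=> s t Is It; have [st|ts|->] := ltgtP s t; first exact: lt_case.
  - by rewrite distrC (distrC t); exact: lt_case.
  - by rewrite !subrr !normr0 mulr0.
move=> Is It st; have Ist z : z \in `[s, t] -> I z.
  by rewrite in_itv/=; exact: itvI.
have [z|z|c] := @MVT R f df s t st.
- by move=> /subset_itv_oo_cc/Ist; exact: f'.
- apply: derivable_within_continuous => {}z /Ist Iz.
  by have [] := f' _ Iz.
- move=> /subset_itv_oo_cc/Ist Ic ->.
  by rewrite normrM ler_wpM2r// dfC.
Qed.

(** The norm is the sup norm, so the scalar inequality applies to each coordinate with the same
    constant. *)
Lemma norm_rV_derive_le (R : realType) N (I : set R) (x dx : R -> 'rV[R]_N) C :
  is_interval I -> (forall t, I t -> is_derive t 1 x (dx t)) ->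
  (forall t, I t -> `|dx t| <= C) ->
  forall s t, I s -> I t -> `|x t - x s| <= C * `|t - s|.
Proof.
move=> itvI x' dxC s t Is It; have C0 : 0 <= C by exact: le_trans (dxC _ Is).
apply: mx_norm_le => [|i j]; first by rewrite mulr_ge0.
rewrite !mxE ord1 {i}.
apply: (@norm_derive_le R I (fun z => x z 0 j) (fun z => dx z 0 j)) => // z Iz.
  by have /is_derive_rowP := x' _ Iz; exact.
by apply: le_trans (dxC _ Iz); exact: le_coord_mx_norm.
Qed.

(** * Estimates by geometric sequences of ratio 1/2 *)

Lemma geometric_half_lt (R : realType) (C e : R) : 0 < e ->
  exists n, C * 2^-1 ^+ n < e.
Proof.
move=> e0; have half1 : `|2^-1 : R| < 1 by rewrite ger0_norm//; lra.
have /cvgrPdist_lt/(_ e e0)[n _ /(_ n (leqnn n))] := cvg_geometric C half1.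
by rewrite sub0r normrN => /ltr_normlW; exists n.
Qed.

Lemma geometric_half_le0 (R : realType) (C a : R) :
  (forall n, a <= C * 2^-1 ^+ n) -> a <= 0.
Proof.
move=> aC; rewrite leNgt; apply/negP => /(geometric_half_lt C)[n].
by rewrite ltNge aC.
Qed.

Lemma geometric_half_cvg (R : realType) N (x : nat -> 'rV[R]_N) C :
  (forall n, `|x n.+1 - x n| <= C * 2^-1 ^+ n) ->
  exists l, forall n, `|l - x n| <= 2 * C * 2^-1 ^+ n.
Proof.
(* The bound is the exact partial sum of the geometric series, which is what makes the induction on
   [k] close. *)
move=> xC; have tail k n :
    `|x (n + k)%N - x n| <= 2 * C * 2^-1 ^+ n - 2 * C * 2^-1 ^+ (n + k).
  elim: k => [|k IHk]; first by rewrite addn0 !subrr normr0.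
  rewrite addnS -(subrKA (x (n + k)%N)) (le_trans (ler_normD _ _))//.
  have := xC (n + k)%N; have := IHk; rewrite exprS.
  move: (2^-1 ^+ (n + k)) => a; lra.
have C0 : 0 <= C.
  by have := xC 0%N; rewrite expr0 mulr1; exact: le_trans (normr_ge0 _).
have {}tail n m : (n <= m)%N -> `|x m - x n| <= 2 * C * 2^-1 ^+ n.
  move=> /subnKC <-; apply: le_trans (tail _ _) _.
  by rewrite gerBl !mulr_ge0// exprn_ge0.
have /cauchy_cvgP/cvg_ex[/= l xl] : cauchy (x @ \oo).
  apply: cauchy_exP => e e0.
  have [n ne] := geometric_half_lt (2 * C) e0.
  exists (x n), n => // m /= nm; rewrite -ball_normE/= distrC.
  exact: le_lt_trans (tail _ _ nm) ne.
exists l => n; apply/ler_addgt0Pr => e e0.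
have /cvgrPdist_le/(_ e e0)[m _ /(_ (maxn m n))] := xl.
rewrite /= leq_maxl => /(_ isT) lm.
rewrite -(subrKA (x (maxn m n))) (le_trans (ler_normD _ _))// addrC lerD//.
by rewrite tail// leq_maxr.
Qed.

(** * Projection onto a segment, and antiderivatives with uniform bounds *)

(** For [a <= b] this is the nearest-point projection of the line onto [a, b]. It freezes functions
    outside a time interval and retracts space onto a box. *)
Definition clamp (R : realType) (a b t : R) := Num.max a (Num.min b t).

Lemma clamp_id (R : realType) (a b t : R) : a <= t <= b -> clamp a b t = t.
Proof. by move=> /andP[at_ tb]; rewrite /clamp min_r// max_r. Qed.

Lemma clamp_itv (R : realType) (a b t : R) : a <= b -> a <= clamp a b t <= b.
Proof. by move=> ab; rewrite le_max lexx/= ge_max ab ge_min lexx. Qed.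

Lemma clamp_lipschitz (R : realType) (a b s t : R) :
  `|clamp a b s - clamp a b t| <= `|s - t|.
Proof.
have := ler_norm (s - t); have := ler_norm (t - s); rewrite distrC ler_norml.
move: `|s - t| => d ? ?; rewrite /clamp.
by case: (leP b s) => ?; case: (leP b t) => ?; case: (leP a b) => ?;
   case: (leP a s) => ?; case: (leP a t) => ?; lra.
Qed.

Lemma clamp_continuous (R : realType) (a b : R) : continuous (clamp a b).
Proof.
move=> t; apply: continuous_max; first exact: cvg_cst.
by apply: continuous_min; [exact: cvg_cst|exact: cvg_id].
Qed.

(* The antiderivative is first taken on a larger interval, so that it is
   differentiable at the endpoints, and then frozen outside [t0 - h, t0 + h]. *)
Lemma antiderivative (R : realType) (t0 h : R) : 0 <= h ->
  exists2 A : (R -> R) -> R -> R, A (cst 0) = cst 0 &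
  forall g : R -> R, continuous g ->
  [/\ continuous (A g), A g t0 = 0,
      forall t, `|t - t0| < h -> is_derive t 1 (A g) (g t) &
      forall (g' : R -> R) (C : R), continuous g' ->
        (forall t, `|g t - g' t| <= C) -> forall t, `|A g t - A g' t| <= C * h].
Proof.
move=> h0; set a := t0 - h - 1; set b := t0 + h + 1.
pose F g x : R := (\int[lebesgue_measure]_(t in [set` `[a, x]]) g t)%R.
have F' g : continuous g -> forall x, a < x < b -> is_derive x 1 (F g) (g x).
  move=> cg x /andP[ax xb].
  have gi : lebesgue_measure.-integrable `[a, b] (EFin \o g).
    apply: continuous_compact_integrable; first exact: segment_compact.
    exact: continuous_subspaceT.
  have [dF] := continuous_FTC1_closed xb gi ax (cg x).
  by rewrite derive1E => <-; exact: derivableP.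
pose c := clamp (t0 - h) (t0 + h).
have cab t : a < c t < b.
  have : t0 - h <= c t <= t0 + h by apply: clamp_itv; lra.
  by rewrite /a /b; lra.
have c0 : c t0 = t0 by apply: clamp_id; lra.
have Fc g : continuous g -> continuous (F g \o c).
  move=> cg t; apply: continuous_comp; first exact: clamp_continuous.
  apply: differentiable_continuous; apply/derivable1_diffP.
  by have [] := F' g cg _ (cab t).
exists (fun g t => F g (c t) - F g t0) => [|g cg].
  by apply/funext => t; rewrite /F /Rintegral !integral0_eq// subrr.
split.
- by move=> t; apply: cvgB; [exact: Fc|exact: cvg_cst].
- by rewrite c0 subrr.
- move=> t; rewrite ltr_norml => th.
  have th' : a < t < b by rewrite /a /b; lra.
  apply: (@near_eq_is_derive _ _ _ (fun s => F g s - F g t0)).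
    have : \forall s \near t, s \in `]t0 - h, t0 + h[.
      by apply: near_in_itvoo; rewrite in_itv/=; lra.
    apply: filterS => s; rewrite in_itv/= => st.
    by rewrite /c clamp_id//; lra.
  by have := F' g cg t th' => ?; apply: is_derive_eq; rewrite subr0.
- move=> g' C cg' gg' t.
  have C0 : 0 <= C by exact: le_trans (gg' t0).
  (* The mean value inequality is applied to [F g - F g'] between [t0] and [c t], which are at
     distance at most [h]. *)
  rewrite (_ : _ - _ = F g (c t) - F g' (c t) - (F g t0 - F g' t0));
    last by ring.
  have ab : is_interval [set` `]a, b[] by exact: interval_is_interval.
  have D' s : [set` `]a, b[] s ->
      is_derive s 1 (fun z => F g z - F g' z) (g s - g' s).
    rewrite /= in_itv/= => sab.
    by have := F' g cg s sab; have := F' g' cg' s sab => ? ?; exact: is_derive_eq.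
  have := norm_derive_le ab D' (fun s _ => gg' s) (s := t0) (t := c t).
  rewrite /= !in_itv/= cab => H; have := H _ isT.
  have -> : a < t0 < b by rewrite /a /b; lra.
  move=> /(_ isT).
  move/le_trans; apply; rewrite ler_wpM2l// ler_norml.
  have : t0 - h <= c t <= t0 + h by apply: clamp_itv; lra.
  lra.
Qed.

Lemma continuous_rV (R : realType) (T : topologicalType) N
    (x : T -> 'rV[R]_N) :
  (forall i, continuous (fun t => x t 0 i)) -> continuous x.
Proof.
move=> cx t; apply/cvgrPdist_le => /= e e0; near=> s.
apply: mx_norm_le => [|i j]; first exact: ltW.
rewrite !mxE ord1 {i}; move: j; near: s; apply: filter_forall => j /=.
exact: ((cvgrPdist_le _ _).1 (cx j t)).
Unshelve. all: by end_near. Qed.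

Lemma antiderivative_rV (R : realType) N (t0 h : R) : 0 <= h ->
  exists2 A : (R -> 'rV[R]_N) -> R -> 'rV[R]_N, A (cst 0) = cst 0 &
  forall g : R -> 'rV[R]_N, continuous g ->
  [/\ continuous (A g), A g t0 = 0,
      forall t, `|t - t0| < h -> is_derive t 1 (A g) (g t) &
      forall (g' : R -> 'rV[R]_N) C, continuous g' ->
        (forall t, `|g t - g' t| <= C) -> forall t, `|A g t - A g' t| <= C * h].
Proof.
move=> h0; have [A A0 AP] := antiderivative t0 h0.
have cc (g : R -> 'rV[R]_N) i : continuous g -> continuous (fun t => g t 0 i).
  move=> cg t; apply: (@continuous_comp _ _ _ g (fun M : 'rV[R]_N => M 0 i)).
    exact: cg.
  exact: coord_continuous.
exists (fun g t => \row_i A (fun s => g s 0 i) t) => [|g cg].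
  apply/funext => t; apply/rowP => i; rewrite !mxE.
  have -> : (fun s => (cst 0 : R -> 'rV[R]_N) s 0 i) = cst 0.
    by apply/funext => s; rewrite /= mxE.
  by rewrite A0 /= mxE.
split.
- apply: continuous_rV => i; under eq_fun do rewrite mxE.
  by have [] := AP _ (cc _ i cg).
- by apply/rowP => i; rewrite !mxE; have [] := AP _ (cc _ i cg).
- move=> t th; apply/is_derive_rowP => i.
  under [X in is_derive _ _ X]eq_fun do rewrite mxE.
  by have [_ _ + _] := AP _ (cc _ i cg); exact.
- move=> g' C cg' gg' t.
  apply: mx_norm_le => [|i j].
    by rewrite mulr_ge0//; exact: le_trans (gg' t0).
  rewrite !mxE.
  have [_ _ _ + //] := AP _ (cc _ j cg); apply; first exact: cc.
  move=> s; apply: le_trans (gg' s).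
  by have := le_coord_mx_norm (g s - g' s) 0 j; rewrite !mxE.
Qed.

(** * Existence and uniqueness of integral curves of Lipschitz fields *)

Lemma lipschitz_continuous (R : realType) (V W : normedModType R) (U : V -> W) K :
  (forall x y, `|U x - U y| <= K * `|x - y|) -> continuous U.
Proof.
move=> UK x; apply/cvgrPdist_lt => e e0.
(* The sign of [K] is not prescribed; [|K| + 1] is a positive Lipschitz constant. *)
have K1 : 0 < `|K| + 1 by rewrite ltr_wpDl.
near=> y; apply: le_lt_trans (UK _ _) _.
apply: (@le_lt_trans _ _ ((`|K| + 1) * `|x - y|)).
  by rewrite ler_wpM2r// ler_wpDr// ler_norm.
rewrite -ltr_pdivlMl//; near: y.
move/cvgrPdist_lt : (@cvg_id _ (nbhs x)); apply.
by rewrite mulr_gt0// invr_gt0.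
Unshelve. all: by end_near. Qed.

(* Picard iteration, on a time interval so short that it halves distances. *)
Lemma picard_lindelof_lipschitz (R : realType) N (U : 'rV[R]_N -> 'rV[R]_N)
    (K t0 : R) (p : 'rV[R]_N) :
  (forall x y, `|U x - U y| <= K * `|x - y|) ->
  exists h (x : R -> 'rV[R]_N), [/\ 0 < h, x t0 = p &
    forall t, `|t - t0| < h -> is_derive t 1 x (U (x t))].
Proof.
move=> UK; have cU := lipschitz_continuous UK.
pose L := `|K| + 1; have L0 : 0 < L by rewrite ltr_wpDl.
have UL x y : `|U x - U y| <= L * `|x - y|.
  by apply: le_trans (UK x y) _; rewrite ler_wpM2r// ler_wpDr// ler_norm.
pose h := (2 * L)^-1; have h0 : 0 < h by rewrite invr_gt0 mulr_gt0.
have [A A0 AP] := antiderivative_rV N t0 (ltW h0).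
pose step x : R -> 'rV[R]_N := fun t => p + A (U \o x) t.
have cUx (x : R -> 'rV[R]_N) : continuous x -> continuous (U \o x).
  by move=> cx s; apply: (@continuous_comp _ _ _ x U); [exact: cx|exact: cU].
have step_c (x : R -> 'rV[R]_N) : continuous x -> continuous (step x).
  move=> cx t; apply: cvgD; first exact: cvg_cst.
  by have [+ _ _ _] := AP _ (cUx _ cx); exact.
have step_half (x y : R -> 'rV[R]_N) c : continuous x -> continuous y ->
    (forall t, `|x t - y t| <= c) ->
    forall t, `|step x t - step y t| <= c * 2^-1.
  move=> cx cy xyc t; rewrite /step opprD addrACA subrr add0r.
  have [_ _ _ /(_ (U \o y) (L * c))] := AP _ (cUx _ cx).
  move=> /(_ (cUx _ cy)) H.
  apply: le_trans (H _ t) _.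
    by move=> s; apply: le_trans (UL _ _) _; rewrite ler_wpM2l// ltW.
  by rewrite (_ : L * c * h = c * 2^-1)// /h; field; rewrite gt_eqF.
pose x n := iter n step (cst p).
have cx n : continuous (x n).
  by elim: n => [|n IHn]; [exact: cst_continuous|exact: step_c].
(* The first increment is the antiderivative of the constant [U p]; comparing it with that of 0,
   which is 0, bounds it uniformly in time. *)
have [C xC] : exists C, forall t, `|x 1%N t - x 0%N t| <= C.
  have [_ _ _ /(_ (cst 0) `|U p| (@cst_continuous _ _ _))] := AP _ (cUx _ (cx 0%N)).
  move=> H; exists (`|U p| * h) => t.
  rewrite /= /step addrC addKr -[A _ t]subr0 -[0](_ : cst 0 t = 0)// -A0.
  by apply: H => s; rewrite subr0.
have {}xC n t : `|x n.+1 t - x n t| <= C * 2^-1 ^+ n.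
  elim: n t => [|n IHn] t; first by rewrite expr0 mulr1.
  by rewrite exprSr mulrA; exact: (step_half (x n.+1) (x n) _ (cx _) (cx _) IHn).
have /choice[y yx] t := geometric_half_cvg (fun n => xC n t).
(* The limit is uniform in time: two errors of at most e/4 and the continuity of one iterate within
   e/2. *)
have cy : continuous y.
  move=> t; apply/cvgrPdist_lt => e e0.
  have [n ne] := geometric_half_lt (2 * C) (divr_gt0 e0 (ltr0n R 4)).
  have /cvgrPdist_lt/(_ (e / 2) (divr_gt0 e0 (ltr0n R 2))) := cx n t.
  apply: filterS => s xts.
  have := ler_normD (y t - x n t) (x n t - y s).
  have := ler_normD (x n t - x n s) (x n s - y s).
  rewrite !subrKA; have := yx t n; have := yx s n.
  by rewrite (distrC (x n s)) ; lra.
exists h, y; have yE : y = step y.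
  apply/funext => t; apply/subr0_eq/normr0_eq0/le_anti.
  rewrite normr_ge0 andbT.
  (* Both [y] and [step y] are within [C * 2^-1 ^+ n] of the iterate of index [n.+1], the latter
     because [step] halves the distance from [x n] to [y]. *)
  apply: (@geometric_half_le0 _ (2 * C)) => n.
  rewrite -(subrKA (x n.+1 t)) (le_trans (ler_normD _ _))//.
  have xy s : `|x n s - y s| <= 2 * C * 2^-1 ^+ n by rewrite distrC.
  have := step_half _ _ _ (cx n) cy xy t; have := yx t n.+1.
  by rewrite -/(x n.+1) exprS; lra.
split => //.
  by rewrite yE /step; have [_ -> _ _] := AP _ (cUx _ cy); rewrite addr0.
move=> t th; rewrite {1}yE.
have [_ _ /(_ t th) + _] := AP _ (cUx _ cy).
by move=> ?; apply: is_derive_eq; rewrite add0r.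
Qed.

Lemma is_derive1_continuous (R : realType) (V : normedModType R) (x : R -> V)
    (t : R) (dx : V) : is_derive t 1 x dx -> {for t, continuous x}.
Proof. by move=> [/derivable1_diffP/differentiable_continuous]. Qed.

Definition lipschitz_near (R : realType) (V W : normedModType R) (U : V -> W)
    (p : V) (r K : R) :=
  forall x y, `|x - p| <= r -> `|y - p| <= r -> `|U x - U y| <= K * `|x - y|.

Lemma picard_lindelof (R : realType) N (U : 'rV[R]_N -> 'rV[R]_N)
    (t0 : R) (p : 'rV[R]_N) (r K : R) : 0 < r -> lipschitz_near U p r K ->
  exists h (x : R -> 'rV[R]_N), [/\ 0 < h, x t0 = p &
    forall t, `|t - t0| < h -> `|x t - p| <= r /\ is_derive t 1 x (U (x t))].
Proof.
move=> r0 UK.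
(* U is made globally Lipschitz by composing it with the retraction onto the
   ball of radius r, a box in the sup norm. *)
pose c (x : 'rV[R]_N) := \row_i clamp (p 0 i - r) (p 0 i + r) (x 0 i).
have cr x : `|c x - p| <= r.
  apply: mx_norm_le => [|i j]; first exact: ltW.
  rewrite !mxE ord1 ler_distl; apply: clamp_itv; lra.
have c_id x : `|x - p| <= r -> c x = x.
  move=> xr; apply/rowP => i; rewrite mxE clamp_id// -ler_distl.
  by apply: le_trans xr; have := le_coord_mx_norm (x - p) 0 i; rewrite !mxE.
have cK x y : `|U (c x) - U (c y)| <= `|K| * `|x - y|.
  apply: le_trans (UK _ _ (cr _) (cr _)) _.
  apply: (@le_trans _ _ (`|K| * `|c x - c y|)).
    by rewrite ler_wpM2r// ler_norm.
  rewrite ler_wpM2l//; apply: mx_norm_le => // i j.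
  rewrite !mxE; apply: le_trans (clamp_lipschitz _ _ _ _) _.
  by have := le_coord_mx_norm (x - y) 0 j; rewrite !mxE.
have [h [x [h0 x0 x']]] := picard_lindelof_lipschitz t0 p cK.
have xc : {for t0, continuous x}.
  by apply: is_derive1_continuous (x' t0 _); rewrite subrr normr0.
(* By continuity the curve stays in the ball for a short time, and there the retraction is the
   identity. *)
have /cvgrPdist_le/(_ r r0)/nbhs_ballP[d /= d0 dP] := xc.
exists (Num.min h d), x; split => // [|t]; first by rewrite lt_min h0.
rewrite lt_min => /andP[th td].
have xr : `|x t - p| <= r.
  by rewrite distrC -x0; apply: dP; rewrite -ball_normE/= distrC.
by split=> //; rewrite -[X in U X]c_id//; exact: x'.
Qed.

(** On a time interval of radius at most 1/(2L), the mean value inequality halves any uniform bound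
    on [|x t - y t|]. Starting from 2r, the bound tends to 0. *)
Lemma ode_unique (R : realType) N (U : 'rV[R]_N -> 'rV[R]_N)
    (t0 : R) (x y : R -> 'rV[R]_N) (r K : R) :
  0 < r -> lipschitz_near U (x t0) r K -> x t0 = y t0 ->
  (\forall t \near t0, is_derive t (1 : R) x (U (x t)) /\
                       is_derive t (1 : R) y (U (y t))) ->
  \forall t \near t0, x t = y t.
Proof.
move=> r0 UK xy0 xy'.
have [/is_derive1_continuous xc /is_derive1_continuous yc] := nbhs_singleton xy'.
have xr : \forall t \near t0, `|x t0 - x t| <= r.
  by have /cvgrPdist_le := xc; exact.
have yr : \forall t \near t0, `|y t0 - y t| <= r.
  by have /cvgrPdist_le := yc; exact.
have /nbhs_ballP[d /= d0 dP] : \forall t \near t0,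
    [/\ is_derive (t : R) (1 : R) x (U (x t)),
        is_derive (t : R) (1 : R) y (U (y t)),
        `|x t0 - x t| <= r & `|y t0 - y t| <= r].
  by apply: filterS3 xy' xr yr => t [].
pose L := `|K| + 1; have L0 : 0 < L by rewrite ltr_wpDl.
pose h := Num.min d (2 * L)^-1; have h0 : 0 < h.
  by rewrite lt_min d0 invr_gt0 mulr_gt0.
have hd t : ball t0 h t -> ball t0 d t by apply: le_ball; rewrite ge_min lexx.
have diff_le n t : ball t0 h t -> `|x t - y t| <= 2 * r * 2^-1 ^+ n.
  elim: n t => [|n IHn] t th.
    have [_ _] := dP _ (hd _ th); rewrite expr0 mulr1 -xy0.
    by have := ler_distD (x t0) (x t) (y t); rewrite (distrC (x t) (x t0)); lra.
  pose w s := x s - y s; pose w' s := U (x s) - U (y s).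
  have : `|w t - w t0| <= L * (2 * r * 2^-1 ^+ n) * `|t - t0|.
    apply: (@norm_rV_derive_le R N (ball t0 h) w w') => [|s sh|s sh| |//].
    - by rewrite ball_itv; exact: interval_is_interval.
    - by have [? ? _ _] := dP _ (hd _ sh); exact: is_deriveB.
    - have [_ _ xs ys] := dP _ (hd _ sh).
      apply: le_trans (UK _ _ _ _) _; first by rewrite distrC.
        by rewrite xy0 distrC.
      apply: (@le_trans _ _ (L * `|x s - y s|)).
        by rewrite ler_wpM2r// ler_wpDr// ler_norm.
      by rewrite ler_wpM2l ?IHn// ltW.
    - exact: ballxx.
  rewrite /w xy0 subrr subr0 => /le_trans; apply.
  have Lt : L * `|t - t0| <= 2^-1.
    rewrite -ler_pdivlMl// -invfM mulrC.
    move: th; rewrite -ball_normE/= distrC => /ltW/le_trans; apply.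
    by rewrite /h ge_min mulrC lexx orbT.
  have a0 : 0 <= 2 * r * 2^-1 ^+ n by rewrite !mulr_ge0 ?exprn_ge0// ltW.
  by rewrite exprS (mulrCA (2 * r)) mulrAC ler_wpM2r.
apply/nbhs_ballP; exists h => // t th; apply/subr0_eq/normr0_eq0/le_anti.
by rewrite normr_ge0 andbT (@geometric_half_le0 _ (2 * r))// => n; exact: diff_le.
Qed.

(** * Smooth functions *)

(** The first-order expansion of [f] at [x] is also one of [g], and uniqueness identifies its linear
    part with the differential of [g]. *)
Lemma near_eq_differentiable (R : numFieldType) (V W : normedModType R)
    (f g : V -> W) (x : V) :
  (\forall y \near x, f y = g y) -> differentiable f x -> differentiable g x.
Proof.
move=> fg df.
have fgx : f x = g x by exact: (nbhs_singleton fg).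
have gE : g \o shift x = cst (g x) + 'd f x +o_ (0 : V) id.
  apply/eqaddoP => e e0.
  move/eqaddoP : (diff_locally df) => /(_ e e0).
  have : \forall h \near (0 : V), f (h + x) = g (h + x).
    by move: fg; rewrite (near_shift 0 x) subr0.
  apply: filterS2 => h /= fgh; rewrite !fctE /=.
  by rewrite -fgh -fgx.
apply/diff_locallyP.
have dc : continuous ('d f x) by exact: diff_continuous.
by rewrite (diff_unique dc gE).
Qed.

Section Ck.
Context {R : realType} {N : nat} (U : set 'rV[R]_N).
Hypothesis openU : open U.
Implicit Types f g : 'rV[R]_N -> R.

(** Since [U] is open, equality on [U] is equality of germs, which passes to all partial
    derivatives. The closure properties below use this to replace a derivative by its formula. *)
Lemma Ck_on_ext k f g :
  (forall x, U x -> f x = g x) -> Ck_on k U f -> Ck_on k U g.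
Proof.
move=> fg.
have near_fg x : U x -> \forall y \near x, f y = g y.
  by move=> Ux; apply: filterS (open_nbhs_nbhs (conj openU Ux)) => y /fg.
elim: k f g fg near_fg => [|k IHk] f g fg near_fg.
  move=> cf x Ux; rewrite /prop_for /continuous_at -fg//.
  have gfx : {near nbhs x, f =1 g} := near_fg x Ux.
  exact: (cvg_trans (near_eq_cvg gfx) (cf x Ux)).
move=> [df Df]; split=> [x Ux|i].
  by apply: near_eq_differentiable (df x Ux); exact: near_fg.
have Dfg x : U x -> 'D_(delta_mx 0 i) f x = 'D_(delta_mx 0 i) g x.
  by move=> Ux; apply: near_eq_derive; exact: near_fg.
apply: IHk (Df i) => // x Ux.
by apply: filterS (open_nbhs_nbhs (conj openU Ux)) => y /Dfg.
Qed.

Lemma Ck_onW k f : Ck_on k.+1 U f -> Ck_on k U f.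
Proof.
elim: k f => [|k IHk] f [df Df].
  by move=> x /df/differentiable_continuous.
by split=> // i; exact: IHk.
Qed.

Lemma Ck_on_cst k (c : R) : Ck_on k U (cst c).
Proof.
elim: k c => [|k IHk] c; first by move=> x _; exact: cst_continuous.
split=> [x _|i]; first exact: differentiable_cst.
by apply: Ck_on_ext (IHk 0) => x _; rewrite derive_cst.
Qed.

Lemma Ck_on_coord k i : Ck_on k U (fun x => x 0 i).
Proof.
case: k => [|k]; first by move=> x _; exact: coord_continuous.
split=> [x _|j]; first exact: differentiable_coord.
apply: Ck_on_ext (Ck_on_cst k ((delta_mx 0 j : 'rV[R]_N) 0 i)) => x _.
have /is_derive_rowP/(_ i) := @is_derive_id R 'rV[R]_N x (delta_mx 0 j).
by move=> ?; rewrite derive_val.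
Qed.

Lemma Ck_onD k f g :
  Ck_on k U f -> Ck_on k U g -> Ck_on k U (fun x => f x + g x).
Proof.
elim: k f g => [|k IHk] f g.
  by move=> cf cg x Ux; exact: cvgD (cf x Ux) (cg x Ux).
move=> [df Df] [dg Dg]; split=> [x Ux|i].
  by apply: differentiableD; [exact: df|exact: dg].
apply: Ck_on_ext (IHk _ _ (Df i) (Dg i)) => x Ux.
by rewrite -deriveD//; apply: diff_derivable; [exact: df|exact: dg].
Qed.

Lemma Ck_onM k f g :
  Ck_on k U f -> Ck_on k U g -> Ck_on k U (fun x => f x * g x).
Proof.
elim: k f g => [|k IHk] f g.
  by move=> cf cg x Ux; exact: cvgM (cf x Ux) (cg x Ux).
move=> Cf Cg; have [[df Df] [dg Dg]] := (Cf, Cg); split=> [x Ux|i].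
  by apply: differentiableM; [exact: df|exact: dg].
apply: Ck_on_ext (Ck_onD (IHk _ _ (Ck_onW Cf) (Dg i))
  (IHk _ _ (Ck_onW Cg) (Df i))) => x Ux.
by rewrite deriveM//; apply: diff_derivable; [exact: df|exact: dg].
Qed.

Lemma Ck_onN k f : Ck_on k U f -> Ck_on k U (fun x => - f x).
Proof.
move=> Cf; apply: Ck_on_ext (Ck_onM (Ck_on_cst k (-1)) Cf) => x _.
by rewrite /= mulN1r.
Qed.

Lemma Ck_onB k f g :
  Ck_on k U f -> Ck_on k U g -> Ck_on k U (fun x => f x - g x).
Proof. by move=> Cf Cg; apply: Ck_onD => //; exact: Ck_onN. Qed.

(** The partial derivatives of 1/f are those of f times -(1/f)^2, so the order grows by one from the
    induction hypothesis on 1/f itself. *)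
Lemma Ck_onV k f : (forall x, U x -> f x != 0) ->
  Ck_on k U f -> Ck_on k U (fun x => (f x)^-1).
Proof.
move=> f0; elim: k => [|k IHk].
  by move=> cf x Ux; exact: cvgV (f0 x Ux) (cf x Ux).
move=> Cf; have [df Df] := Cf; split=> [x Ux|i].
  by apply: differentiableV; [exact: df|exact: f0].
have CV := IHk (Ck_onW Cf).
apply: Ck_on_ext (Ck_onN (Ck_onM (Ck_onM CV CV) (Df i))) => x Ux.
rewrite deriveV ?f0//; last by apply: diff_derivable; exact: df.
by rewrite expr2 invfM scaleNr.
Qed.

Lemma Ck_onX k f n : Ck_on k U f -> Ck_on k U (fun x => f x ^+ n).
Proof.
move=> Cf; elim: n => [|n IHn].
  by apply: Ck_on_ext (Ck_on_cst k 1) => x _; rewrite expr0.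
by apply: Ck_on_ext (Ck_onM Cf IHn) => x _; rewrite exprS.
Qed.

Lemma Ck_on_sum k (I : Type) (s : seq I) (F : I -> 'rV[R]_N -> R) :
  (forall i, Ck_on k U (F i)) -> Ck_on k U (fun x => \sum_(i <- s) F i x).
Proof.
move=> CF; elim: s => [|i s IHs].
  by apply: Ck_on_ext (Ck_on_cst k 0) => x _; rewrite big_nil.
by apply: Ck_on_ext (Ck_onD (CF i) IHs) => x _; rewrite big_cons.
Qed.

Lemma Ck_on_prod k (I : Type) (s : seq I) (F : I -> 'rV[R]_N -> R) :
  (forall i, Ck_on k U (F i)) -> Ck_on k U (fun x => \prod_(i <- s) F i x).
Proof.
move=> CF; elim: s => [|i s IHs].
  by apply: Ck_on_ext (Ck_on_cst k 1) => x _; rewrite big_nil.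
by apply: Ck_on_ext (Ck_onM (CF i) IHs) => x _; rewrite big_cons.
Qed.

End Ck.

(** * C^1 maps are locally Lipschitz *)

Lemma C1_lipschitz_near (R : realType) N P (U : set 'rV[R]_N)
    (F : 'rV[R]_N -> 'rV[R]_P) (p : 'rV[R]_N) :
  open U -> U p -> (forall j, Ck_on 1 U (fun x => F x 0 j)) ->
  exists r K, 0 < r /\ lipschitz_near F p r K.
Proof.
move=> openU Up C1.
pose D (j : 'I_P) (i : 'I_N) (x : 'rV[R]_N) : R :=
  'D_(delta_mx 0 i) (fun y => F y 0 j) x.
(* A single bound for all partial derivatives near [p]; each summand 1 is the slack allowed by
   continuity. *)
pose B := \sum_j \sum_i (`|D j i p| + 1).
have near_B : \forall x \near p, forall (j : 'I_P) (i : 'I_N), `|D j i x| <= B.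
  apply: (@filter_forall _ _ _ (nbhs p)) => j.
  apply: (@filter_forall _ _ _ (nbhs p)) => i.
  have [_ /(_ i)/(_ p Up) Dc] := C1 j.
  move/cvgrPdist_lt : Dc => /(_ 1 ltr01); apply: filterS => x Dpx.
  apply: (@le_trans _ _ (`|D j i p| + 1)).
    have := ler_distD (D j i p) (D j i x) 0; rewrite !subr0 distrC.
    by move: Dpx; rewrite /D; lra.
  rewrite /B (bigD1 j)//= (bigD1 i)//= -addrA lerDl addr_ge0//.
    by apply: sumr_ge0 => k _; rewrite addr_ge0.
  by do 2!(apply: sumr_ge0 => ? _); rewrite addr_ge0.
have /nbhs_ballP[r /= r0 rP] :
    \forall x \near p, U x /\ forall (j : 'I_P) (i : 'I_N), `|D j i x| <= B.
  by apply: filterS2 (open_nbhs_nbhs (conj openU Up)) near_B => x.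
(* Halving the radius puts the closed ball inside the open one. The factor [N] comes from summing
   over the coordinates of the displacement in the sup norm. *)
exists (r / 2), (N%:R * B); split; first by rewrite divr_gt0.
have B0 : 0 <= B by do 2!(apply: sumr_ge0 => ? _); rewrite addr_ge0.
move=> x y xr yr; pose d : 'rV[R]_N := x - y.
(* The segment from [y] to [x], along which the mean value inequality is applied. *)
pose w (s : R) : 'rV[R]_N := y + s *: d.
have wr (s : R) : 0 <= s <= 1 -> ball p r (w s).
  move=> s01; rewrite -ball_normE/= distrC.
  rewrite (_ : w s - p = s *: (x - p) + (1 - s) *: (y - p)); last first.
    by apply/rowP => i; rewrite /w /d !mxE; ring.
  rewrite (le_lt_trans (ler_normD _ _))// !normrZ.
  rewrite (ger0_norm (_ : 0 <= s)) ?(ger0_norm (_ : 0 <= 1 - s)); try lra.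
  by nra.
have dw (s : R) : is_diff s w ( *:%R^~ d).
  have dC : is_diff s (cst y : R -> 'rV[R]_N) 0 := is_diff_cst _ _.
  have dZ : is_diff s ( *:%R^~ d) ( *:%R^~ d) := is_diff_scalel _ _.
  have := is_diffD dC dZ; rewrite add0r.
  by rewrite (_ : cst y + _ = w)//; apply/funext => z.
have dF (s : R) (j : 'I_P) : 0 <= s <= 1 ->
    is_derive s (1 : R) (fun s => F (w s) 0 j)
      (\sum_(i < N) d 0 i * D j i (w s)).
  move=> s01; have [Uw _] := rP _ (wr s s01).
  have [dFj _] := C1 j; have dFw := dFj _ Uw.
  have wdiff : differentiable w s by have [] := dw s.
  have dFcomp : differentiable (fun s => F (w s) 0 j) s.
    exact: (@differentiable_comp _ _ _ _ w (fun x => F x 0 j)).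
  apply: DeriveDef; first exact/derivable1_diffP.
  rewrite deriveE// (@diff_comp _ _ _ _ w (fun x => F x 0 j))//= diff_val scale1r.
  rewrite [in LHS](row_sum_delta d) linear_sum.
  by apply: eq_bigr => i _; rewrite linearZ /= -deriveE.
have : `|F (w 1) - F (w 0)| <= N%:R * B * `|d| * `|1 - 0|.
  apply: (@norm_rV_derive_le R P [set` `[0, 1]] (F \o w)
    (fun s => \row_j \sum_(i < N) d 0 i * D j i (w s))).
  - exact: interval_is_interval.
  - move=> s /=; rewrite in_itv/= => s01; apply/is_derive_rowP => j.
    by rewrite mxE; exact: dF.
  - move=> s /=; rewrite in_itv/= => s01.
    have [_ DB] := rP _ (wr s s01).
    apply: mx_norm_le => [|i j]; first by rewrite !mulr_ge0.
    rewrite !mxE (le_trans (ler_norm_sum _ _ _))//.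
    apply: (@le_trans _ _ (\sum_(i < N) B * `|d|)).
      apply: ler_sum => k _; rewrite normrM mulrC ler_pM//.
      exact: le_coord_mx_norm.
    by rewrite sumr_const card_ord -[leLHS]mulr_natl mulrA.
  - by rewrite /= in_itv/= lexx ler01.
  - by rewrite /= in_itv/= lexx ler01.
rewrite /w scale1r scale0r addr0 subr0 normr1 mulr1.
by rewrite /d (addrC y) subrK.
Qed.

(** * Solution spaces of autonomous systems *)

Lemma is_derive1_shift (R : realType) (V : normedModType R) (g : R -> V)
    (a s : R) (dg : V) :
  is_derive (a + s) 1 g dg -> is_derive s 1 (fun r => g (a + r)) dg.
Proof.
have E :
    (fun h : R => h^-1 *: (((fun r => g (a + r)) \o shift s) (h *: (1 : R))
                           - g (a + s))) =
    (fun h : R => h^-1 *: ((g \o shift (a + s)) (h *: (1 : R)) - g (a + s))).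
  by apply/funext => h /=; rewrite addrCA.
move=> [gd <-]; apply: DeriveDef; first by rewrite /derivable E.
by rewrite /derive E.
Qed.

(** The general principle: solutions are the integral curves of [v] in [M], and [rho] recovers the
    unknowns from the recorded state. The last hypothesis says that an integral curve meeting [M]
    stays in [M] and is the value curve of the solution read off from it. *)
Lemma dimension_of_flow (R : realType) (T : Type) (N n : nat)
    (sol : set R -> (R -> T) -> Prop) (value : (R -> T) -> R -> 'rV[R]_N)
    (W M : set 'rV[R]_N) (v : 'rV[R]_N -> 'rV[R]_N) (rho : 'rV[R]_N -> T) :
  open W -> smooth_on W v -> M `<=` W -> M !=set0 ->
  smooth_submanifold n.+1 M -> (forall p, M p -> v p != 0) ->
  (forall X Y t, (\forall s \near t, X s = Y s) -> value X t = value Y t) ->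
  (forall X s t, value (translate s X) t = value X (t + s)) ->
  (forall I X, sol I X <-> [/\ open I, is_interval I & forall t, I t ->
    [/\ M (value X t), X t = rho (value X t) &
        is_derive t (1 : R) (value X) (v (value X t))]]) ->
  (forall (I : set R) (x : R -> 'rV[R]_N) t0,
    is_interval I -> open I -> I t0 -> M (x t0) ->
    (forall t, I t -> W (x t) /\ is_derive t (1 : R) x (v (x t))) ->
    forall t, I t -> M (x t) /\ value (rho \o x) t = x t) ->
  dimension_up_to_translation sol value n.
Proof.
move=> openW v_smooth MW [p0 Mp0] Mman v0 value_germ value_shift solP flow t0.
have v_lip p : W p -> exists r K, 0 < r /\ lipschitz_near v p r K.
  by move=> Wp; exact: (C1_lipschitz_near openW Wp (v_smooth 1%N)).
have germE : germ_values sol value t0 = M.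
  apply/seteqP; split=> [p [I [X [/solP[_ _ solX] It0 <-]]]|p Mp].
    by have [] := solX _ It0.
  have [r [K [r0 vK]]] := v_lip _ (MW _ Mp).
  have := open_nbhs_nbhs (conj openW (MW _ Mp)) => /nbhs_ballP[e /= e0 eW].
  (* The radius is shrunk so that the closed ball also lies in [W]. *)
  pose r' := Num.min r (e / 2).
  have r'0 : 0 < r' by rewrite lt_min r0 divr_gt0.
  have vK' : lipschitz_near v p r' K.
    by move=> x y xr yr; apply: vK; [apply: le_trans xr _|apply: le_trans yr _];
       rewrite ge_min lexx.
  have [h [x [h0 xt0 x']]] := picard_lindelof t0 r'0 vK'.
  have Wx t : ball t0 h t -> W (x t) /\ is_derive t (1 : R) x (v (x t)).
    rewrite -ball_normE/= distrC => /x'[xr ?]; split=> //.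
    apply: eW; rewrite -ball_normE/= distrC; apply: le_lt_trans xr _.
    by rewrite gt_min [X in _ || X](_ : _ = true) ?orbT//; lra.
  have itvB : is_interval (ball t0 h).
    by rewrite ball_itv; exact: interval_is_interval.
  have Bt0 : ball t0 h t0 by exact: ballxx.
  have openB : open (ball t0 h) by exact: ball_open.
  have Mx t : ball t0 h t -> M (x t) /\ value (rho \o x) t = x t.
    by apply: (flow _ x t0) => //; rewrite xt0.
  exists (ball t0 h), (rho \o x); split => //; last by have [_ ->] := Mx _ Bt0.
  apply/solP; split=> // t Bt; have [Mxt xtE] := Mx _ Bt.
  rewrite xtE; split=> //; have [_] := Wx _ Bt; apply: near_eq_is_derive.
  have := open_nbhs_nbhs (conj openB Bt).
  by apply: filterS => s /Mx[].
split.
(* Equal values at [t0] give equal state curves near [t0] by uniqueness, and [rho] turns this into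
   equality of the unknowns. *)
- move=> I J X Y /solP[openI _ solX] It0 /solP[openJ _ solY] Jt0.
  split=> [XY|]; last exact: value_germ.
  have nI := open_nbhs_nbhs (conj openI It0).
  have nJ := open_nbhs_nbhs (conj openJ Jt0).
  have [MX _ _] := solX _ It0.
  have [r [K [r0 vK]]] := v_lip _ (MW _ MX).
  have xy : \forall t \near t0, value X t = value Y t.
    apply: (ode_unique r0 vK XY); apply: filterS2 nI nJ => t It Jt.
    by have [_ _ ?] := solX _ It; have [_ _ ?] := solY _ Jt.
  apply: filterS3 nI nJ xy => t It Jt xyt.
  by have [_ -> _] := solX _ It; have [_ -> _] := solY _ Jt; rewrite xyt.
- by rewrite germE; exists p0.
- by rewrite germE.
(* The system is autonomous, so translation in time is the flow of [v] itself. *)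
- exists W, v; rewrite germE; split=> // I X s /solP[openI itvI solX] Is.
  have shiftE t : value (translate s X) t = value X (s + t).
    by rewrite value_shift addrC.
  split.
    apply/solP; split.
    + apply: (@open_comp _ _ (shift s) I) => // t _.
      by apply: cvgD; [exact: cvg_id|exact: cvg_cst].
    + move=> a b /= Ia Ib c /andP[ac cb]; apply: (itvI _ _ Ia Ib).
      by rewrite !lerD2r ac.
    + move=> t /=; rewrite addrC => It; have [MX XE X'] := solX _ It.
      rewrite shiftE; split=> //; first by rewrite /translate addrC.
      under [X in is_derive _ _ X]eq_fun do rewrite shiftE.
      exact: is_derive1_shift.
  under [X in is_derive _ _ X]eq_fun do rewrite value_shift.
  by rewrite value_shift; apply: is_derive1_shift; have [] := solX _ Is.
Qed.

(** * Hypersurfaces cut out by an equation affine in the last coordinate *)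

Definition set_coord (R : Type) N (L : 'I_N) (p : 'rV[R]_N) (c : R) : 'rV[R]_N :=
  \row_j if j == L then c else p 0 j.

Lemma set_coord_smooth (R : realType) N (U : set 'rV[R]_N) (L : 'I_N) g :
  open U -> (forall k, Ck_on k U g) ->
  smooth_on U (fun p => set_coord L p (g p)).
Proof.
move=> openU Cg k j; case: (eqVneq j L) => [->|jL].
  by apply: Ck_on_ext (Cg k) => // x _; rewrite mxE eqxx.
by apply: Ck_on_ext (Ck_on_coord openU k j) => // x _; rewrite mxE (negPf jL).
Qed.

(** Replacing the coordinate [L] by [a p + b p * p 0 L] is a slice chart: as [a] and [b] ignore that
    coordinate and [b] does not vanish, the inverse is (y - a) / b. Since [L] is the last index, the
    slice condition concerns it alone. *)
Lemma smooth_submanifold_hypersurface (R : realType) N d (L : 'I_N)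
    (U : set 'rV[R]_N) (a b : 'rV[R]_N -> R) :
  N = d.+1 -> nat_of_ord L = d -> open U ->
  (forall k, Ck_on k U a) -> (forall k, Ck_on k U b) ->
  (forall p, U p -> b p != 0) ->
  (forall p c, U p -> U (set_coord L p c)) ->
  (forall p c, a (set_coord L p c) = a p) ->
  (forall p c, b (set_coord L p c) = b p) ->
  smooth_submanifold d [set p | U p /\ a p + b p * p 0 L = 0].
Proof.
move=> Nd Ld openU Ca Cb b0 Uc ac bc; split; first by rewrite Nd.
have set_id (p : 'rV[R]_N) c c' :
    c' = p 0 L -> set_coord L (set_coord L p c) c' = p.
  by move=> ->; apply/rowP => j; rewrite !mxE; case: eqVneq => // ->.
have setL (p : 'rV[R]_N) c : set_coord L p c 0 L = c by rewrite mxE eqxx.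
move=> p [Up _].
exists U, U, (fun p => set_coord L p (a p + b p * p 0 L)),
  (fun p => set_coord L p ((p 0 L - a p) / b p)); split.
- by split.
- split; apply: set_coord_smooth => // k.
    by apply: Ck_onD => //; apply: Ck_onM => //; exact: Ck_on_coord.
  apply: Ck_onM => //; last exact: Ck_onV.
  by apply: Ck_onB => //; exact: Ck_on_coord.
- move=> x Ux; split; first exact: Uc.
  by apply: set_id; rewrite setL ac bc addrC addKr mulrC mulKf// b0.
- move=> x Ux; split; first exact: Uc.
  by apply: set_id; rewrite setL ac bc mulrC divfK ?b0// addrC subrK.
- move=> x Ux; split=> [[_ x0] i|x0].
    move=> di; have -> : i = L.
      apply: val_inj => /=; rewrite Ld; apply/eqP; rewrite eqn_leq di andbT.
      by have := ltn_ord i; rewrite {2}Nd ltnS.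
    by rewrite setL.
  by split=> //; have := x0 L; rewrite setL Ld; exact.
Qed.

(** The value functions need to agree only along solutions, at times in their intervals. Openness of
    the intervals makes them agree near each such time, hence also have the same derivative. *)
Lemma dimension_up_to_translation_eq (R : realType) (T : Type) N n
    (sol sol' : set R -> (R -> T) -> Prop)
    (value value' : (R -> T) -> R -> 'rV[R]_N) :
  (forall I X, sol I X <-> sol' I X) -> (forall I X, sol I X -> open I) ->
  (forall I X t, sol I X -> I t -> value X t = value' X t) ->
  dimension_up_to_translation sol' value' n ->
  dimension_up_to_translation sol value n.
Proof.
move=> solE sol_open valueE dim t0.
have [germ ne mfd [W [v [openW GW Cv v0 flow]]]] := dim t0.
have germE : germ_values sol value t0 = germ_values sol' value' t0.
  apply/seteqP; split=> p [I [X [solX It0 <-]]]; exists I, X; split=> //.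
  - exact/solE.
  - by rewrite (valueE I).
  - exact/solE.
  - by rewrite (valueE I)//; exact/solE.
split; rewrite ?germE//.
  move=> I J X Y solX It0 solY Jt0; rewrite (valueE I)// (valueE J)//.
  by apply: (germ I J) => //; exact/solE.
exists W, v; split=> // I X s solX Is.
have solX' : sol' I X by exact/solE.
have trans r : I (t0 + r) -> sol [set t | I (t + r)] (translate r X).
  by move=> Ir; apply/solE; have [] := flow _ _ _ solX' Ir.
split; first exact: trans.
rewrite (valueE [set t | I (t + s)])//; last exact: trans.
have [_] := flow _ _ _ solX' Is; apply: near_eq_is_derive.
have : \forall x \near (t0 + s), I x.
  exact: open_nbhs_nbhs (conj (sol_open _ _ solX) Is).
rewrite (near_shift s (t0 + s)).
apply: filterS => r /=; rewrite addrK (addrC r) => Ir.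
by rewrite (valueE [set t | I (t + r)])//; exact: trans.
Qed.

(** * The soliton system with multiplicities *)

Lemma derive1_shift (R : realType) (V : normedModType R) (g : R -> V)
    (s t : R) :
  derive1 (fun z => g (z + s)) t = derive1 g (t + s).
Proof. by rewrite /derive1; under eq_fun do rewrite -addrA. Qed.

Lemma is_derive_bigsum (R : realType) (I : Type)
    (s : seq I) (h : I -> R -> R) (dh : I -> R) (t : R) :
  (forall i, is_derive t (1 : R) (h i) (dh i)) ->
  is_derive t (1 : R) (fun z => \sum_(i <- s) h i z) (\sum_(i <- s) dh i).
Proof.
move=> h'; elim: s => [|i s IHs].
  under [X in is_derive _ _ X]eq_fun do rewrite big_nil; rewrite big_nil.
  exact: is_derive_cst.
under [X in is_derive _ _ X]eq_fun do rewrite big_cons; rewrite big_cons.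
exact: is_deriveD.
Qed.

(** Logarithmic differentiation, with [l i] in the role of f_i'/f_i, stated without division so that
    zeros of [f i] are allowed. *)
Lemma is_derive_bigprodX (R : realType) (I : Type) (s : seq I) (m : I -> nat)
    (f : I -> R -> R) (l : I -> R) (t : R) :
  (forall i, is_derive t (1 : R) (f i) (l i * f i t)) ->
  is_derive t (1 : R) (fun z => \prod_(i <- s) f i z ^+ m i)
    ((\prod_(i <- s) f i t ^+ m i) * \sum_(i <- s) (m i)%:R * l i).
Proof.
move=> f'; elim: s => [|i s IHs].
  under [X in is_derive _ _ X]eq_fun do rewrite big_nil.
  rewrite !big_nil mulr0; exact: is_derive_cst.
under [X in is_derive _ _ X]eq_fun do rewrite big_cons; rewrite !big_cons.
have := is_deriveX (m i) (f' i); rewrite exprfctE => fX.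
apply: (is_derive_eq (is_deriveM fX IHs)); rewrite /GRing.scale/=.
case: (m i) => [|k]; first by rewrite !expr0; ring.
by rewrite exprS /=; ring.
Qed.

Lemma is_derive_inv (R : realType) (V : normedModType R) (f : V -> R)
    (x v : V) (df : R) :
  is_derive x v f df -> f x != 0 ->
  is_derive x v (fun y => (f y)^-1) (- df / f x ^+ 2).
Proof.
move=> [fd <-] fx0; apply: DeriveDef; first exact: derivableV.
by rewrite deriveV// /GRing.scale/= !mulNr mulrC.
Qed.

(** * The flow field on (f, tau)-space and its first integral *)

Section State.
Context {R : realType} {r : nat}.
Variables (m : 'I_r -> nat) (lambda : R).
Implicit Types p : 'rV[R]_(r + r).

(* A state p lists (f_i)_i and then (tau_i)_i. The prefix d marks the derivative
   along a solution; for du_of_state it is obtained from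
   u = - 1/3 sum_i m_i (tau_i - u f_i^2) / f_i^2 and
   (tau_i - u f_i^2)' = lambda f_i^2. *)
Definition fsq p i := p 0 (lshift r i) ^+ 2.
Definition tau p i := p 0 (rshift r i).
Definition vol p := \prod_i p 0 (lshift r i) ^+ m i.
Definition sumsq p := \sum_i (m i)%:R * fsq p i.
Definition constraint p := \sum_i (m i)%:R * (tau p i / fsq p i).
Definition dfsq p i := tau p i - fsq p i / vol p * (2 * fsq p i - sumsq p).
Definition u_of_state p :=
  ((\sum_i (m i)%:R * tau p i) - 2 * lambda * vol p) / sumsq p.
Definition du_of_state p :=
  3^-1 * (\sum_i (m i)%:R *
           ((tau p i - u_of_state p * fsq p i) * dfsq p i / fsq p i ^+ 2))
  - lambda.
Definition flow_field p : 'rV[R]_(r + r) :=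
  row_mx (\row_i (dfsq p i / (2 * p 0 (lshift r i))))
    (\row_i (lambda * fsq p i + du_of_state p * fsq p i
             + u_of_state p * dfsq p i)).
Definition domain : set 'rV[R]_(r + r) :=
  [set p | forall i, 0 < p 0 (lshift r i)].
Definition states : set 'rV[R]_(r + r) :=
  [set p | domain p /\ constraint p = 0].

Hypothesis m_gt0 : forall i, (0 < m i)%N.
Hypothesis sum_m : (\sum_i m i = 3)%N.

Lemma sum_mR : \sum_i (m i)%:R = 3 :> R.
Proof. by rewrite -natr_sum sum_m. Qed.

Lemma index_gt0 : (0 < r)%N.
Proof.
rewrite lt0n; apply/eqP => r0; move: sum_m; rewrite big1 // => i.
by have := ltn_ord i; rewrite {2}r0.
Qed.

Lemma fsq_gt0 p i : domain p -> 0 < fsq p i.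
Proof. by move=> Dp; rewrite exprn_gt0. Qed.

Lemma vol_gt0 p : domain p -> 0 < vol p.
Proof. by move=> Dp; apply: prodr_gt0 => i _; rewrite exprn_gt0. Qed.

Lemma sumsq_gt0 p : domain p -> 0 < sumsq p.
Proof.
move=> Dp; have i0 := Ordinal index_gt0.
rewrite /sumsq (bigD1 i0)//= ltr_wpDr//.
  by apply: sumr_ge0 => i _; rewrite mulr_ge0// ltW// fsq_gt0.
by rewrite mulr_gt0 ?fsq_gt0// ltr0n.
Qed.

(** Because the multiplicities add up to 3, the terms in S and F_i contribute 3S/P - 2S/P = S/P. The
    sum is twice the logarithmic derivative of P. *)
Lemma sum_dfsq p : domain p ->
  \sum_i (m i)%:R * (dfsq p i / fsq p i) = constraint p + sumsq p / vol p.
Proof.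
move=> Dp; have V0 := vol_gt0 Dp.
transitivity (\sum_i ((m i)%:R * (tau p i / fsq p i)
  + (m i)%:R * (sumsq p / vol p) - 2 * ((m i)%:R * fsq p i) / vol p)).
  apply: eq_bigr => i _; have F0 := fsq_gt0 i Dp; rewrite /dfsq.
  by field; rewrite !gt_eqF.
rewrite sumrB big_split/= -mulr_suml sum_mR -mulr_suml -mulr_sumr.
rewrite -/(constraint p) -/(sumsq p); field; by rewrite gt_eqF.
Qed.

Lemma flow_field_neq0 p : states p -> flow_field p != 0.
Proof.
move=> [Dp p0]; apply/eqP => vp.
have d0 i : dfsq p i = 0.
  have := congr1 (fun q : 'rV_(r + r) => q 0 (lshift r i)) vp.
  rewrite row_mxEl !mxE => /eqP; rewrite mulf_eq0 invr_eq0 mulf_eq0.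
  by rewrite pnatr_eq0/= (gt_eqF (Dp i)) !orbF => /eqP.
have := sum_dfsq Dp; rewrite p0 add0r big1 => [/esym/eqP|i _]; last first.
  by rewrite d0 mul0r mulr0.
by rewrite gt_eqF// divr_gt0// ?sumsq_gt0 ?vol_gt0.
Qed.

Section Curve.
Variables (x : R -> 'rV[R]_(r + r)) (t : R).
Hypothesis Dxt : domain (x t).
Hypothesis df : forall i, is_derive t (1 : R) (fun s => x s 0 (lshift r i))
  (dfsq (x t) i / (2 * x t 0 (lshift r i))).

Lemma is_derive_fsq i :
  is_derive t (1 : R) (fun s => fsq (x s) i) (dfsq (x t) i).
Proof.
have f0 := Dxt i; have := is_deriveX 2 (df i); rewrite exprfctE => df2.
by apply: (is_derive_eq df2); rewrite /GRing.scale/=; field; rewrite gt_eqF.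
Qed.

(** Only the equations for the f_i' enter, so the formula is available before tau is known to be
    differentiable or [constraint] to vanish. *)
Lemma is_derive_vol : is_derive t (1 : R) (fun s => vol (x s))
  (2^-1 * (constraint (x t) * vol (x t) + sumsq (x t))).
Proof.
have V0 := vol_gt0 Dxt.
have := @is_derive_bigprodX R _ (index_enum 'I_r) m
  (fun i s => x s 0 (lshift r i)) (fun i => 2^-1 * (dfsq (x t) i / fsq (x t) i)) t.
case=> [i|dvol volE]; last first.
  apply: DeriveDef => //; rewrite volE -/(vol (x t)).
  under eq_bigr do rewrite mulrCA.
  by rewrite -mulr_sumr sum_dfsq//; field; rewrite gt_eqF.
apply: (is_derive_eq (df i)); rewrite /fsq; have := Dxt i.
by move=> ?; field; rewrite gt_eqF.
Qed.

Lemma is_derive_sumsq : is_derive t (1 : R) (fun s => sumsq (x s))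
  (\sum_i (m i)%:R * dfsq (x t) i).
Proof.
rewrite /sumsq; apply: is_derive_bigsum => i.
exact: (is_deriveZ (m i)%:R (is_derive_fsq i)).
Qed.

End Curve.

(** On g = 0 the sum is -3u. The right-hand side involves tau_i only through w_i = tau_i - u F_i,
    whose derivative the soliton system prescribes. *)
Lemma u_of_state_eq p : states p ->
  u_of_state p =
  - 3^-1 * \sum_i (m i)%:R * ((tau p i - u_of_state p * fsq p i) / fsq p i).
Proof.
move=> [Dp p0].
transitivity (- 3^-1 * (constraint p - u_of_state p * \sum_i (m i)%:R)).
  by rewrite p0 sum_mR; field.
congr (_ * _); rewrite mulr_sumr -sumrB; apply: eq_bigr => i _.
by have := fsq_gt0 i Dp => ?; field; rewrite gt_eqF.
Qed.

Lemma flow_fieldP (x : R -> 'rV[R]_(r + r)) t :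
  is_derive t (1 : R) x (flow_field (x t)) <->
  (forall i, is_derive t (1 : R) (fun s => x s 0 (lshift r i))
    (dfsq (x t) i / (2 * x t 0 (lshift r i)))) /\
  (forall i, is_derive t (1 : R) (fun s => tau (x s) i)
    (lambda * fsq (x t) i + du_of_state (x t) * fsq (x t) i
     + u_of_state (x t) * dfsq (x t) i)).
Proof.
rewrite is_derive_rowP; split=> [H|[Hf Ht] j].
  split=> i.
    by have := H (lshift r i); rewrite row_mxEl mxE.
  by have := H (rshift r i); rewrite row_mxEr mxE.
case: (split_ordP j) => i ->.
  by rewrite row_mxEl mxE.
by rewrite row_mxEr mxE; exact: Ht.
Qed.

(** The derivative is 3 (lambda + u') - sum_i m_i w_i F_i' / F_i^2, where u' stands for
    [du_of_state], chosen to make this vanish on the whole domain. Hence {g = 0} is invariant. *)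
Lemma is_derive_constraint (x : R -> 'rV[R]_(r + r)) t : domain (x t) ->
  is_derive t (1 : R) x (flow_field (x t)) ->
  is_derive t (1 : R) (fun s => constraint (x s)) 0.
Proof.
move=> Dxt /flow_fieldP[df dt].
have df2 i := is_derive_fsq Dxt df i.
pose c i := (lambda + du_of_state (x t)) * (m i)%:R -
  (m i)%:R * ((tau (x t) i - u_of_state (x t) * fsq (x t) i)
              * dfsq (x t) i / fsq (x t) i ^+ 2).
have dconstr : is_derive t (1 : R) (fun s => constraint (x s)) (\sum_i c i).
  rewrite /constraint; apply: is_derive_bigsum => i.
  have F0 : fsq (x t) i != 0 by rewrite gt_eqF// fsq_gt0.
  have dV := is_derive_inv (df2 i) F0.
  apply: (is_derive_eq (is_deriveZ (m i)%:R (is_deriveM (dt i) dV))).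
  by rewrite /c /GRing.scale/=; field.
apply: (is_derive_eq dconstr).
by rewrite /c sumrB -mulr_sumr sum_mR /du_of_state; field.
Qed.

(** Consistency of [du_of_state] with the quotient defining u: on g = 0 one has 2 lambda P' = lambda
    S, so the numerator u S has derivative u' S + u S', with u' the value of [du_of_state]. *)
Lemma is_derive_u_of_state (x : R -> 'rV[R]_(r + r)) t : states (x t) ->
  is_derive t (1 : R) x (flow_field (x t)) ->
  is_derive t (1 : R) (fun s => u_of_state (x s)) (du_of_state (x t)).
Proof.
move=> [Dxt xt0] /flow_fieldP[df dt].
have S0 : sumsq (x t) != 0 by rewrite gt_eqF// sumsq_gt0.
have dS := is_derive_sumsq Dxt df.
have dV := is_derive_vol Dxt df.
have dT : is_derive t (1 : R) (fun s => \sum_i (m i)%:R * tau (x s) i)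
    (\sum_i (m i)%:R * (lambda * fsq (x t) i + du_of_state (x t) * fsq (x t) i
                        + u_of_state (x t) * dfsq (x t) i)).
  apply: is_derive_bigsum => i; exact: (is_deriveZ (m i)%:R (dt i)).
have := is_deriveM (is_deriveB dT (is_deriveZ (2 * lambda) dV))
  (is_derive_inv dS S0).
move=> H; apply: (is_derive_eq H); rewrite /GRing.scale/= xt0.
have sumE : \sum_i (m i)%:R * (lambda * fsq (x t) i + du_of_state (x t) * fsq (x t) i
    + u_of_state (x t) * dfsq (x t) i)
    = (lambda + du_of_state (x t)) * sumsq (x t)
      + u_of_state (x t) * \sum_i (m i)%:R * dfsq (x t) i.
  by rewrite /sumsq !mulr_sumr -big_split/=; apply: eq_bigr => i _; ring.
rewrite sumE.
have -> : ((fun s => \sum_i (m i)%:R * tau (x s) i)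
           - (2 * lambda) \*: (fun s => vol (x s))) t
    = u_of_state (x t) * sumsq (x t).
  by rewrite /u_of_state divfK.
by field.
Qed.

End State.

(** * Equivalence of the weighted soliton system with the flow on {g = 0} *)

Section WeightedSoliton.
Context {R : realType} {r : nat}.
Variables (m : 'I_r -> nat) (lambda : R).
Implicit Types (X : R -> 'rV[R]_r * R) (I : set R).

Definition profile X (i : 'I_r) (t : R) : R := (X t).1 0 i.

Definition weighted_tau X (i : 'I_r) (t : R) : R :=
  derive1 (fun s => profile X i s ^+ 2) t
  + profile X i t ^+ 2 / (\prod_j profile X j t ^+ m j)
    * (2 * profile X i t ^+ 2 - \sum_j (m j)%:R * profile X j t ^+ 2).

Definition weighted_value X (t : R) : 'rV[R]_(r + r) :=
  row_mx (\row_i profile X i t) (\row_i weighted_tau X i t).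

Definition weighted_soliton I X : Prop :=
  [/\ open I, is_interval I & forall t, I t ->
  [/\ forall i, 0 < profile X i t /\ derivable (profile X i) t 1,
      2 * derive1 (fun s => \prod_i profile X i s ^+ m i) t
        = \sum_i (m i)%:R * profile X i t ^+ 2,
      forall i, is_derive t (1 : R)
        (fun s => weighted_tau X i s - (X s).2 * profile X i s ^+ 2)
        (lambda * profile X i t ^+ 2) &
      \sum_i (m i)%:R * weighted_tau X i t
        = (X t).2 * (\sum_i (m i)%:R * profile X i t ^+ 2)
          + 2 * lambda * \prod_i profile X i t ^+ m i]].

Definition soliton_of_state (p : 'rV[R]_(r + r)) : 'rV[R]_r * R :=
  (\row_i p 0 (lshift r i), u_of_state m lambda p).

Lemma value_f X t i : weighted_value X t 0 (lshift r i) = profile X i t.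
Proof. by rewrite row_mxEl mxE. Qed.

Lemma value_tau X t i : tau (weighted_value X t) i = weighted_tau X i t.
Proof. by rewrite /tau row_mxEr mxE. Qed.

Lemma value_fsq X t i : fsq (weighted_value X t) i = profile X i t ^+ 2.
Proof. by rewrite /fsq value_f. Qed.

Lemma value_vol X t : vol m (weighted_value X t) = \prod_i profile X i t ^+ m i.
Proof. by apply: eq_bigr => i _; rewrite value_f. Qed.

Lemma value_sumsq X t :
  sumsq m (weighted_value X t) = \sum_i (m i)%:R * profile X i t ^+ 2.
Proof. by apply: eq_bigr => i _; rewrite value_fsq. Qed.

Lemma value_dfsq X t i :
  dfsq m (weighted_value X t) i = derive1 (fun s => profile X i s ^+ 2) t.
Proof.
by rewrite /dfsq value_tau value_fsq value_vol value_sumsq /weighted_tau addrK.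
Qed.

Hypothesis m_gt0 : forall i, (0 < m i)%N.
Hypothesis sum_m : (\sum_i m i = 3)%N.

(** The system only makes the combinations w_i differentiable; that u and the tau_i are
    differentiable separately has to be derived. *)
Lemma weighted_soliton_flow I X : weighted_soliton I X <->
  [/\ open I, is_interval I & forall t, I t ->
    [/\ states m (weighted_value X t),
        X t = soliton_of_state (weighted_value X t) &
      is_derive t (1 : R) (weighted_value X)
        (flow_field m lambda (weighted_value X t))]].
Proof.
split=> -[openI itvI H]; split=> // t It.
- pose x := weighted_value X.
  have nI := open_nbhs_nbhs (conj openI It).
  (* The algebraic consequences are established on all of [I], since they are differentiated at [t]
     below. *)
  have H1 s : I s -> [/\ states m (x s), (X s).2 = u_of_state m lambda (x s) &
      forall i, is_derive s (1 : R) (fun z => x z 0 (lshift r i))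
        (dfsq m (x s) i / (2 * x s 0 (lshift r i)))].
    move=> Is; have [f_gt0 vol' tau' sum_tau] := H _ Is.
    have Dx : domain (x s) by move=> i; rewrite value_f; have [] := f_gt0 i.
    have df i : is_derive s (1 : R) (fun z => x z 0 (lshift r i))
        (dfsq m (x s) i / (2 * x s 0 (lshift r i))).
      have [fi0 /derivableP fid] := f_gt0 i.
      have fE : (fun z => x z 0 (lshift r i)) = profile X i.
        by apply/funext => z; rewrite value_f.
      rewrite fE; apply: (is_derive_eq fid).
      have := is_deriveX 2 fid; rewrite exprfctE => f2.
      rewrite value_dfsq value_f derive1E (@derive_val _ _ _ _ _ _ _ f2).
      rewrite /GRing.scale/=.
      by field; rewrite gt_eqF.
    have V0 := vol_gt0 m Dx.
    have g0 : constraint m (x s) = 0.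
      have dV := is_derive_vol sum_m Dx df.
      have volE : (fun z => vol m (x z)) =
          (fun z => \prod_i profile X i z ^+ m i).
        by apply/funext => z; rewrite value_vol.
      (* Comparing 2 P' = g P + S with the first equation 2 P' = S gives g P = 0, and P > 0. *)
      move: vol'; rewrite -volE derive1E (@derive_val _ _ _ _ _ _ _ dV).
      rewrite -value_sumsq -/(x s).
      rewrite mulrA divff ?pnatr_eq0// mul1r => /eqP.
      rewrite -subr_eq0 addrK mulf_eq0 (gt_eqF V0) orbF => /eqP//.
    split=> //; rewrite /u_of_state.
    under eq_bigr do rewrite value_tau.
    rewrite sum_tau value_sumsq value_vol addrK mulfK//.
    by rewrite -value_sumsq gt_eqF// (sumsq_gt0 m_gt0 sum_m Dx).
  have [Sx uE df] := H1 _ It; have [Dx g0] := Sx.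
  have df2 i := is_derive_fsq Dx df i.
  split=> //.
    rewrite [LHS]surjective_pairing uE; congr (_, _).
    by apply/rowP => i; rewrite mxE value_f.
  have [_ _ w' _] := H _ It.
  have {}w' i : is_derive t (1 : R)
      (fun s => tau (x s) i - u_of_state m lambda (x s) * fsq (x s) i)
      (lambda * fsq (x t) i).
    rewrite value_fsq; apply: near_eq_is_derive (w' i).
    apply: filterS nI => s /H1[_ us _].
    by rewrite value_tau value_fsq us.
  have du : is_derive t (1 : R) (fun s => u_of_state m lambda (x s))
      (du_of_state m lambda (x t)).
    (* Near [t], u equals this expression in the w_i and F_i, all differentiable; this yields u'
       although u was not assumed differentiable. *)
    pose w s := - 3^-1 * \sum_i (m i)%:R *
       ((tau (x s) i - u_of_state m lambda (x s) * fsq (x s) i) / fsq (x s) i).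
    apply: (@near_eq_is_derive _ _ _ w).
      apply: filterS nI => s /H1[Ss _ _].
      by rewrite /w -(u_of_state_eq lambda sum_m Ss).
    pose c i := lambda * (m i)%:R - (m i)%:R *
      ((tau (x t) i - u_of_state m lambda (x t) * fsq (x t) i)
       * dfsq m (x t) i / fsq (x t) i ^+ 2).
    have dc : is_derive t (1 : R) (fun s => \sum_i (m i)%:R *
       ((tau (x s) i - u_of_state m lambda (x s) * fsq (x s) i) / fsq (x s) i))
       (\sum_i c i).
      apply: is_derive_bigsum => i.
      have F0 : fsq (x t) i != 0 by rewrite gt_eqF// fsq_gt0.
      have := is_deriveZ (m i)%:R
        (is_deriveM (w' i) (is_derive_inv (df2 i) F0)).
      move=> H2; apply: (is_derive_eq H2).
      by rewrite /c /GRing.scale/=; field.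
    apply: (is_derive_eq (is_deriveZ (- 3^-1) dc)).
    by rewrite /c sumrB -mulr_sumr sum_mR// /du_of_state /GRing.scale/=; field.
  apply/flow_fieldP; split=> // i.
  (* tau_i is differentiable as w_i + u F_i. *)
  have := is_deriveD (w' i) (is_deriveM du (df2 i)).
  rewrite (_ : _ + _ = fun s => tau (x s) i); last first.
    by apply/funext => s; rewrite /= subrK.
  by move=> H2; apply: (is_derive_eq H2); rewrite /GRing.scale/=; ring.
- have nI := open_nbhs_nbhs (conj openI It).
  have [Sx XE x'] := H _ It; have [Dx g0] := Sx.
  have /flow_fieldP[df dt] := x'.
  have fE i : (fun z => weighted_value X z 0 (lshift r i)) = profile X i.
    by apply/funext => z; rewrite value_f.
  have uE s : I s -> (X s).2 = u_of_state m lambda (weighted_value X s).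
    by move=> /H[_ -> _].
  split.
  + move=> i; split; first by have := Dx i; rewrite value_f.
    by have [+ _] := df i; rewrite fE.
  + have dV := is_derive_vol sum_m Dx df.
    have volE : (fun z => vol m (weighted_value X z)) =
        (fun z => \prod_i profile X i z ^+ m i).
      by apply/funext => z; rewrite value_vol.
    rewrite -volE derive1E (@derive_val _ _ _ _ _ _ _ dV) g0 value_sumsq.
    by field.
  + move=> i.
    have df2 := is_derive_fsq Dx df i.
    have du := is_derive_u_of_state m_gt0 sum_m Sx x'.
    apply: (@near_eq_is_derive _ _ _ (fun s => tau (weighted_value X s) i -
        u_of_state m lambda (weighted_value X s) * fsq (weighted_value X s) i)).
      by apply: filterS nI => s /uE ->; rewrite value_tau value_fsq.
    apply: (is_derive_eq (is_deriveB (dt i) (is_deriveM du df2))).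
    by rewrite /GRing.scale/= -value_fsq; ring.
  + rewrite (uE _ It) -value_sumsq -value_vol /u_of_state divfK; last first.
      by rewrite gt_eqF// (sumsq_gt0 m_gt0 sum_m Dx).
    by rewrite subrK; apply: eq_bigr => i _; rewrite value_tau.
Qed.

End WeightedSoliton.

(** * Smoothness of the state space and dimension of the weighted system *)

Section StateSpace.
Context {R : realType} {q : nat}.
Notation r := q.+1.
Variables (m : 'I_r -> nat) (lambda : R).

Lemma open_domain : open (@domain R r).
Proof.
rewrite openE => p Dp; apply: (@filter_forall _ _ _ (nbhs p)) => i.
exact: cvgr_gt (@coord_continuous _ _ _ 0 (lshift r i) p) _ (Dp i).
Qed.

Lemma Ck_on_fsq k i : Ck_on k domain (fun p : 'rV[R]_(r + r) => fsq p i).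
Proof.
by apply: Ck_onX; [exact: open_domain|apply: Ck_on_coord; exact: open_domain].
Qed.

Hypothesis m_gt0 : forall i, (0 < m i)%N.
Hypothesis sum_m : (\sum_i m i = 3)%N.

Let openD := open_domain.

Lemma smooth_flow_field : smooth_on domain (flow_field m lambda).
Proof.
have Cf k i : Ck_on k domain (fun p : 'rV[R]_(r + r) => p 0 (lshift r i)).
  exact: Ck_on_coord.
have Ct k i : Ck_on k domain (fun p : 'rV[R]_(r + r) => tau p i).
  exact: Ck_on_coord.
have CF k i : Ck_on k domain (fun p : 'rV[R]_(r + r) => fsq p i).
  exact: Ck_on_fsq.
have Cc k c : Ck_on k (@domain R r) (fun=> c) by exact: Ck_on_cst.
have CV k : Ck_on k domain (fun p : 'rV[R]_(r + r) => vol m p).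
  by apply: Ck_on_prod => // i; exact: Ck_onX.
have CS k : Ck_on k domain (fun p : 'rV[R]_(r + r) => sumsq m p).
  by apply: Ck_on_sum => // i; exact: Ck_onM.
have Cdf k i : Ck_on k domain (fun p : 'rV[R]_(r + r) => dfsq m p i).
  apply: Ck_onB => //; apply: Ck_onM => //; last first.
    by apply: Ck_onB => //; exact: Ck_onM.
  apply: Ck_onM => //; apply: Ck_onV => // p Dp.
  by rewrite gt_eqF// vol_gt0.
have Cu k : Ck_on k domain (fun p : 'rV[R]_(r + r) => u_of_state m lambda p).
  apply: Ck_onM => //; last first.
    by apply: Ck_onV => // p Dp; rewrite gt_eqF// sumsq_gt0.
  apply: Ck_onB => //; last exact: Ck_onM.
  by apply: Ck_on_sum => // i; exact: Ck_onM.
have Cdu k : Ck_on k domain (fun p : 'rV[R]_(r + r) => du_of_state m lambda p).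
  apply: Ck_onB => //; apply: Ck_onM => //; apply: Ck_on_sum => // i.
  apply: Ck_onM => //; apply: Ck_onM => //.
    by apply: Ck_onM => //; apply: Ck_onB => //; exact: Ck_onM.
  apply: Ck_onV => //; first by move=> p Dp; rewrite gt_eqF// exprn_gt0// fsq_gt0.
  exact: Ck_onX.
move=> k j; case: (split_ordP j) => i ->.
  apply: (@Ck_on_ext _ _ _ openD _ (fun p => dfsq m p i / (2 * p 0 (lshift r i)))).
    by move=> p _; rewrite row_mxEl mxE.
  apply: Ck_onM => //; apply: Ck_onV => //; last exact: Ck_onM.
  by move=> p Dp; rewrite mulf_neq0// gt_eqF.
apply: (@Ck_on_ext _ _ _ openD _ (fun p =>
    lambda * fsq p i + du_of_state m lambda p * fsq p i
    + u_of_state m lambda p * dfsq m p i)).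
  by move=> p _; rewrite row_mxEr mxE.
apply: Ck_onD => //; last exact: Ck_onM.
by apply: Ck_onD => //; exact: Ck_onM.
Qed.

(** [constraint] is affine in the last tau_i, with the positive coefficient m_i / F_i, and the other
    terms do not involve that coordinate. *)
Lemma states_submanifold : smooth_submanifold (q + q).+1 (@states R r m).
Proof.
pose L : 'I_(r + r) := rshift r ord_max.
pose a (p : 'rV[R]_(r + r)) :=
  \sum_(i | i != ord_max) (m i)%:R * (tau p i / fsq p i).
pose b (p : 'rV[R]_(r + r)) := (m ord_max)%:R / fsq p ord_max.
rewrite (_ : states m = [set p | domain p /\ a p + b p * p 0 L = 0]); last first.
  apply/seteqP; split=> p [Dp p0]; split=> //; move: p0;
    rewrite /constraint (bigD1 ord_max)//= -/(a p) addrC /b mulrAC mulrA//.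
have f_set p c i : set_coord L p c 0 (lshift r i) = p 0 (lshift r i).
  by rewrite mxE eq_lrshift.
have F_set p c i : fsq (set_coord L p c) i = fsq p i by rewrite /fsq f_set.
have t_set p c i : i != ord_max -> tau (set_coord L p c) i = tau p i.
  by move=> im; rewrite /tau mxE eq_rshift (negPf im).
apply: (@smooth_submanifold_hypersurface _ _ _ L) => //.
- by rewrite addSn addnS.
- move=> k; rewrite /a.
  under [X in Ck_on _ _ X]eq_fun do rewrite big_mkcond.
  apply: Ck_on_sum => // i; case: (i != ord_max) => /=; last exact: Ck_on_cst.
  apply: Ck_onM => //; first exact: Ck_on_cst.
  apply: Ck_onM => //; first exact: Ck_on_coord.
  by apply: Ck_onV => //; [move=> p Dp; rewrite gt_eqF// fsq_gt0|exact: Ck_on_fsq].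
- move=> k; apply: Ck_onM => //; first exact: Ck_on_cst.
  by apply: Ck_onV => //; [move=> p Dp; rewrite gt_eqF// fsq_gt0|exact: Ck_on_fsq].
- by move=> p Dp; rewrite mulf_neq0// ?invr_eq0 ?gt_eqF ?fsq_gt0// ltr0n.
- by move=> p c Dp i; rewrite f_set.
- by move=> p c; apply: eq_bigr => i im; rewrite F_set t_set.
- by move=> p c; rewrite /b F_set.
Qed.

Lemma weighted_dimension :
  dimension_up_to_translation (weighted_soliton m lambda) (weighted_value m)
    (q + q).
Proof.
apply: (@dimension_of_flow R _ _ _ _ _ domain (states m) (flow_field m lambda)
  (soliton_of_state m lambda)).
- exact: open_domain.
- exact: smooth_flow_field.
- by move=> p [].
(* The state with all f_i = 1 and all tau_i = 0. *)
- exists (row_mx (const_mx 1) 0); split.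
    by move=> i; rewrite row_mxEl mxE.
  by apply: big1 => i _; rewrite /tau row_mxEr mxE mul0r mulr0.
- exact: states_submanifold.
- by move=> p; exact: flow_field_neq0.
- move=> X Y t XY; have XYt := nbhs_singleton XY.
  have fE i : profile X i t = profile Y i t by rewrite /profile XYt.
  rewrite /weighted_value; congr row_mx; apply/rowP => i; rewrite !mxE// /weighted_tau.
  congr (_ + _).
    rewrite !derive1E; apply: near_eq_derive.
    by apply: filterS XY => s XYs; rewrite /profile XYs.
  rewrite fE; congr (_ / _ * (_ - _)); apply: eq_bigr => j _; by rewrite fE.
- move=> X s t; rewrite /weighted_value; congr row_mx.
  apply/rowP => i; rewrite !mxE /weighted_tau; congr (_ + _).
  exact: (derive1_shift (fun z => profile X i z ^+ 2)).
- exact: weighted_soliton_flow.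
- move=> I x t0 itvI openI It0 [Dx0 x00] H.
  (* [constraint] has zero derivative along the curve and vanishes at [t0]. *)
  have Sx t : I t -> states m (x t).
    move=> It; have [Dxt x't] := H _ It; split=> //.
    have dg s : I s -> is_derive s (1 : R) (fun z => constraint m (x z)) 0.
      by move=> /H[? ?]; apply: is_derive_constraint.
    have d0 s : I s -> `|0 : R| <= 0 by rewrite normr0.
    have := @norm_derive_le R I _ (fun=> 0) 0 itvI dg d0 t0 t It0 It.
    by rewrite x00 subr0 mul0r normr_le0 => /eqP.
  move=> t It; split; first exact: Sx.
  have [Dxt x't] := H _ It; have /flow_fieldP[df _] := x't.
  have fE i s : profile (soliton_of_state m lambda \o x) i s = x s 0 (lshift r i).
    by rewrite /profile mxE.
  (* The equations for the f_i' are the definition of tau solved for (f_i^2)', so tau computed from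
     the f_i is the tau-coordinate of the state. *)
  rewrite -[RHS]hsubmxK; congr row_mx; apply/rowP => i; rewrite !mxE ?fE//.
  have dF := is_derive_fsq Dxt df i.
  rewrite /weighted_tau (_ : (fun s => _) = fun s => fsq (x s) i); last first.
    by apply/funext => s; rewrite fE.
  rewrite derive1E (@derive_val _ _ _ _ _ _ _ dF) fE.
  under eq_bigr do rewrite fE.
  under [X in _ * (_ - X)]eq_bigr do rewrite fE.
  by rewrite /dfsq subrK.
Qed.

End StateSpace.

(** * The two soliton systems as weighted systems *)

Lemma SU3_dimension (R : realType) (lambda : R) :
  dimension_up_to_translation (SU3_soliton lambda) SU3_value 4.
Proof.
(* Three functions of multiplicity 1, so q = 2 and the dimension is 2 + 2. *)
pose m (i : 'I_3) := 1%N.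
have prodE X t : SU3_prod X t = \prod_i profile X i t ^+ m i :> R by [].
have sumE X t : SU3_sumsq X t = \sum_i (m i)%:R * profile X i t ^+ 2 :> R.
  by apply: eq_bigr => i _; rewrite mul1r.
have tauE (X : R -> 'rV[R]_3 * R) i t : SU3_tau X i t = weighted_tau m X i t.
  by rewrite /SU3_tau sumE.
apply: (@dimension_up_to_translation_eq _ _ _ _ _ (weighted_soliton m lambda) _
  (weighted_value m)).
- move=> I X; split=> -[openI itvI H]; split=> // t /H[f_gt0 vol' tau' sum_tau].
    split=> //; first by rewrite -sumE.
      move=> i; have := tau' i; rewrite (_ : (fun s => _) =
        fun s => weighted_tau m X i s - (X s).2 * profile X i s ^+ 2)//.
      by apply/funext => s; rewrite tauE.
    rewrite -sumE -prodE -sum_tau; apply: eq_bigr => i _.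
    by rewrite tauE mul1r.
  split=> //; first by rewrite sumE.
    move=> i; have := tau' i; rewrite (_ : (fun s => _) =
      fun s => SU3_tau X i s - SU3_u X s * SU3_f X i s ^+ 2)//.
    by apply/funext => s; rewrite tauE.
  rewrite sumE -sum_tau; apply: eq_bigr => i _.
  by rewrite tauE mul1r.
- by move=> I X [].
- move=> I X t _ _; rewrite /SU3_value /weighted_value; congr row_mx.
  by apply/rowP => i; rewrite !mxE tauE.
- by apply: (@weighted_dimension R 2); rewrite // !big_ord_recl big_ord0.
Qed.

Lemma Sp2_dimension (R : realType) (lambda : R) :
  dimension_up_to_translation (Sp2_soliton lambda) Sp2_value 2.
Proof.
(* Multiplicities 1 and 2, since f_2 also stands for f_3; here q = 1 and the dimension is 1 + 1. *)
pose m (i : 'I_2) := i.+1.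
have I2 (i : 'I_2) : i = 0 \/ i = 1.
  by case: i => [[|[|//]] i2]; [left|right]; exact: val_inj.
have ord1E : lift ord0 ord0 = 1 :> 'I_2 by exact: val_inj.
have prodE (X : R -> 'rV[R]_2 * R) t :
    \prod_i profile X i t ^+ m i = Sp2_f1 X t * Sp2_f2 X t ^+ 2.
  by rewrite !big_ord_recl big_ord0 ord1E mulr1 expr1.
have volE (X : R -> 'rV[R]_2 * R) : (fun s => \prod_i profile X i s ^+ m i) =
    fun s => Sp2_f1 X s * Sp2_f2 X s ^+ 2.
  by apply/funext => s; exact: prodE.
have sumE (X : R -> 'rV[R]_2 * R) t : \sum_i (m i)%:R * profile X i t ^+ 2
    = Sp2_f1 X t ^+ 2 + 2 * Sp2_f2 X t ^+ 2.
  by rewrite !big_ord_recl big_ord0 ord1E addr0 mul1r.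
have sumtauE (F : 'I_2 -> R) : \sum_i (m i)%:R * F i = F 0 + 2 * F 1.
  by rewrite !big_ord_recl big_ord0 ord1E addr0 mul1r.
(* The simplified formulas for tau cancel powers of f_1 and f_2, which uses positivity; derivatives
   are therefore transferred through equality near points of the open interval. *)
have tau1E (X : R -> 'rV[R]_2 * R) t : 0 < Sp2_f1 X t -> 0 < Sp2_f2 X t ->
    Sp2_tau1 X t = weighted_tau m X 0 t.
  move=> f1 f2; rewrite /Sp2_tau1 /weighted_tau prodE sumE -addrA; congr (_ + _).
  by rewrite /profile -/(Sp2_f1 X t); field; rewrite !gt_eqF.
have tau2E (X : R -> 'rV[R]_2 * R) t : 0 < Sp2_f1 X t -> 0 < Sp2_f2 X t ->
    Sp2_tau2 X t = weighted_tau m X 1 t.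
  move=> f1 f2; rewrite /Sp2_tau2 /weighted_tau prodE sumE; congr (_ + _).
  by rewrite /profile -/(Sp2_f2 X t); field; rewrite !gt_eqF.
apply: (@dimension_up_to_translation_eq _ _ _ _ _ (weighted_soliton m lambda) _
  (weighted_value m)).
- move=> I X; split=> -[openI itvI H]; split=> // t It.
    have nI := open_nbhs_nbhs (conj openI It).
    have [[f1 f1' f2 f2'] vol' dtau1 dtau2 sum_tau] := H _ It.
    split.
    + by move=> i; have [->|->] := I2 i.
    + by rewrite volE sumE.
    + move=> i; have [->|->] := I2 i.
        apply: near_eq_is_derive dtau1; apply: filterS nI => s /H[[? _ ? _] _ _ _ _].
        by rewrite tau1E.
      apply: near_eq_is_derive dtau2; apply: filterS nI => s /H[[? _ ? _] _ _ _ _].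
      by rewrite tau2E.
    + by rewrite sumtauE sumE prodE -tau1E// -tau2E.
  have nI := open_nbhs_nbhs (conj openI It).
  have pos s : I s -> 0 < Sp2_f1 X s /\ 0 < Sp2_f2 X s.
    by move=> /H[f_gt0 _ _ _]; split; [have [] := f_gt0 0|have [] := f_gt0 1].
  have [f_gt0 vol' dtau sum_tau] := H _ It; have [f1 f2] := pos _ It.
  split.
  + by have [? ?] := f_gt0 0; have [? ?] := f_gt0 1.
  + by rewrite -volE -sumE.
  + apply: near_eq_is_derive (dtau 0); apply: filterS nI => s /pos[? ?].
    by rewrite tau1E.
  + apply: near_eq_is_derive (dtau 1); apply: filterS nI => s /pos[? ?].
    by rewrite tau2E.
  + by rewrite -sumE -prodE tau1E// tau2E// -sum_tau sumtauE.
- by move=> I X [].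
- move=> I X t [_ _ H] /H[[f1 _ f2 _] _ _ _ _].
  apply/rowP => j; rewrite mxE.
  case: (@split_ordP 2 2 j) => i ->; have [->|->] := I2 i.
  + by rewrite row_mxEl mxE.
  + by rewrite row_mxEl mxE.
  + by rewrite row_mxEr mxE -tau1E.
  + by rewrite row_mxEr mxE -tau2E.
- by apply: (@weighted_dimension R 1); rewrite // !big_ord_recl big_ord0.
Qed.

Unset Implicit Arguments.

Theorem theorem1 (R : realType) (lambda : R) :
  dimension_up_to_translation (Sp2_soliton lambda) Sp2_value 2 /\
  dimension_up_to_translation (SU3_soliton lambda) SU3_value 4.
Proof. by split; [exact: Sp2_dimension|exact: SU3_dimension]. Qed.
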